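(* Let $m,n,d\in\mathbb{N}$ with $d\ge m+n+\min\{m,n\}$, let $\ell:\mathbb{R}^{m\times n}\to\mathbb{R}$ be locally Lipschitz, let $\mathcal{H}_{\mathrm{MF}}:\mathbb{R}^{d\times m}\times\mathbb{R}^{d\times n}\to\mathbb{R}^{m\times n}$, $\mathcal{H}_{\mathrm{MF}}(X,Y):=X^{\mathrm T}Y$, and let $f:=\ell\circ\mathcal{H}_{\mathrm{MF}}$, i.e. $f(X,Y)=\ell(X^{\mathrm T}Y)$. Then the subdifferential chain rule of $f$ holds everywhere: for every $(X,Y)\in\mathbb{R}^{d\times m}\times\mathbb{R}^{d\times n}$, $$\partial_C f(X,Y)=J_{\mathcal{H}_{\mathrm{MF}}}(X,Y)^{\mathrm T}\,\partial_C\ell(X^{\mathrm T}Y).$$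
   Context: $\mathbb{N}$ is the set of positive integers. Matrix spaces and their products are identified with Euclidean spaces via the Frobenius inner product; $J_{\mathcal{H}}(x)$ denotes the Jacobian of a mapping $\mathcal{H}$ at $x$, $J_{\mathcal{H}}(x)^{\mathrm T}$ its transpose (adjoint), and $J^{\mathrm T}S:=\{J^{\mathrm T}s:s\in S\}$ for a set $S$. For a locally Lipschitz $f:\mathbb{R}^N\to\mathbb{R}$, the Clarke subdifferential at $x$ is $\partial_C f(x):=\operatorname{conv}\{s:\exists\, y_k\to x,\ f\text{ differentiable at each }y_k,\ \nabla f(y_k)\to s\}$. *)

(* Defs.v *)
From HB Require Import structures.
From mathcomp Require Import all_boot all_order all_algebra.
From mathcomp Require Import all_classical all_reals all_analysis.

Set Implicit Arguments.
Unset Strict Implicit.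
Unset Printing Implicit Defensive.

Import Order.TTheory GRing.Theory Num.Theory.
Import numFieldNormedType.Exports.

Local Open Scope classical_set_scope.
Local Open Scope ring_scope.

Definition frob (R : realType) (m n : nat) (A B : 'M[R]_(m, n)) : R :=
  \tr (A^T *m B).

Definition frob_pair (R : realType) (d m n : nat)
    (P Q : 'M[R]_(d, m) * 'M[R]_(d, n)) : R :=
  frob P.1 Q.1 + frob P.2 Q.2.

(* The vector representing a linear form [phi] with respect to the inner
   product [ip]; existence for [frob] and [frob_pair] is proved below, and
   uniqueness is positive definiteness. *)
Definition riesz (R : realType) (V : normedModType R) (ip : V -> V -> R)
    (phi : V -> R) : V :=
  get [set v | forall u, ip v u = phi u].

Definition adjoint (R : realType) (V W : normedModType R)
    (ipV : V -> V -> R) (ipW : W -> W -> R) (L : V -> W) (w : W) : V :=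
  riesz ipV (fun u => ipW w (L u)).

Definition gradient (R : realType) (V : normedModType R) (ip : V -> V -> R)
    (f : V -> R) (x : V) : V :=
  riesz ip ('d f x).

(* The transposed Jacobian is the adjoint of the Frechet derivative ['d H x],
   as ['J] of the library only covers maps between spaces of row vectors. *)
Definition jacobian_tr (R : realType) (V W : normedModType R)
    (ipV : V -> V -> R) (ipW : W -> W -> R) (H : V -> W) (x : V) : W -> V :=
  adjoint ipV ipW ('d H x).

Definition conv_hull (R : realType) (V : lmodType R) (S : set V) : set V :=
  smallest (@convex_set R V) S.

(* The library's norm on matrices is the entrywise maximum, and on pairs the
   maximum of the two norms. They are equivalent to the Frobenius norm, so that
   local Lipschitz continuity, differentiability and convergence are those of
   the Euclidean structure; only [ip] depends on the choice of Euclidean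
   structure. *)
Definition locally_lipschitz (R : realType) (V W : normedModType R)
    (f : V -> W) : Prop :=
  forall x : V, exists2 U : set V, nbhs x U & [lipschitz f z | z in U].

Definition limiting_gradients (R : realType) (V : normedModType R)
    (ip : V -> V -> R) (f : V -> R) (x : V) : set V :=
  [set s | exists y : nat -> V,
     [/\ y k @[k --> \oo] --> x,
         forall k, differentiable f (y k) &
         gradient ip f (y k) @[k --> \oo] --> s]].

Definition clarke_subdiff (R : realType) (V : normedModType R)
    (ip : V -> V -> R) (f : V -> R) (x : V) : set V :=
  conv_hull (limiting_gradients ip f x).

Definition H_MF (R : realType) (d m n : nat)
    (P : 'M[R]_(d, m) * 'M[R]_(d, n)) : 'M[R]_(m, n) :=
  P.1^T *m P.2.

Lemma frobE (R : realType) (m n : nat) (A B : 'M[R]_(m, n)) :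
  frob A B = \sum_i \sum_j A i j * B i j.
Proof.
rewrite /frob /mxtrace exchange_big /=; apply: eq_bigr => j _.
by rewrite mxE; apply: eq_bigr => i _; rewrite mxE.
Qed.

Lemma frob_repr (R : realType) (m n : nat)
    (phi : {linear 'M[R]_(m, n) -> R^o}) (B : 'M[R]_(m, n)) :
  frob (\matrix_(i, j) phi (delta_mx i j)) B = phi B.
Proof.
rewrite frobE [in RHS](matrix_sum_delta B) linear_sum /=.
apply: eq_bigr => i _; rewrite linear_sum /=; apply: eq_bigr => j _.
by rewrite linearZ mxE /= mulrC.
Qed.

Lemma frob_riesz (R : realType) (m n : nat)
    (phi : {linear 'M[R]_(m, n) -> R^o}) (B : 'M[R]_(m, n)) :
  frob (riesz (@frob R m n) phi) B = phi B.
Proof.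
rewrite /riesz; set S := (X in get X).
have /getPex : exists v, S v by eexists => B'; exact: frob_repr.
exact.
Qed.

Lemma frob_pair_riesz (R : realType) (d m n : nat)
    (phi : {linear ('M[R]_(d, m) * 'M[R]_(d, n))%type -> R^o})
    (Q : 'M[R]_(d, m) * 'M[R]_(d, n)) :
  frob_pair (riesz (@frob_pair R d m n) phi) Q = phi Q.
Proof.
rewrite /riesz; set S := (X in get X).
suff /getPex : exists v, S v by exact.
pose p1 (A : 'M[R]_(d, m)) : R^o := phi (A, 0).
pose p2 (B : 'M[R]_(d, n)) : R^o := phi (0, B).
have l1 : linear p1.
  move=> a A B; rewrite /p1 -linearP; congr (phi _).
  by rewrite /GRing.scale /= /GRing.add /= /scale_pair /add_pair /= scaler0 addr0.
have l2 : linear p2.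
  move=> a A B; rewrite /p2 -linearP; congr (phi _).
  by rewrite /GRing.scale /= /GRing.add /= /scale_pair /add_pair /= scaler0 addr0.
pose q1 : {linear _ -> R^o} := HB.pack p1 (GRing.isLinear.Build _ _ _ _ p1 l1).
pose q2 : {linear _ -> R^o} := HB.pack p2 (GRing.isLinear.Build _ _ _ _ p2 l2).
exists (\matrix_(i, j) q1 (delta_mx i j), \matrix_(i, j) q2 (delta_mx i j)).
move=> [A B]; rewrite /frob_pair /= (frob_repr q1) (frob_repr q2).
rewrite /= /p1 /p2 -linearD; congr (phi _).
by rewrite /GRing.add /= /add_pair /= addr0 add0r.
Qed.

(* Main.v *)
Require Import Defs.
From HB Require Import structures.
From mathcomp Require Import all_boot all_order all_algebra.
From mathcomp Require Import ring lra.
From mathcomp Require Import all_classical all_reals all_analysis.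
Import Order.TTheory GRing.Theory Num.Theory.
Import numFieldNormedType.Exports.
Local Open Scope classical_set_scope.
Local Open Scope ring_scope.

(** For the inclusion from right to left, the differential chain rule turns
    gradients of [ell] at [z] into gradients of the composition at any point over
    [z], and nearby [z] lift to nearby points of the source because the
    factorization map is open everywhere: as [d >= m + n + min m n], there is room
    for [min m n] independent columns orthogonal to those of [X] and [Y], along
    which [X] and [Y] can be perturbed so as to realize any small change of [X^T Y].

    For the other inclusion, the directional derivatives of the composition are
    bounded by the generalized directional derivatives of [ell], whose values are
    attained by limiting gradients of [ell] (Rademacher's theorem and Fubini's
    theorem give points of differentiability on almost every line, where the mean
    value of the derivative is the increment). As the convex hull of the compact set
    of limiting gradients is compact, a limiting gradient of the composition outside
    its image would be strictly separated from it, contradicting that bound.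

    Rademacher's theorem is proved one coordinate at a time. In one variable, a
    monotone Lipschitz function defines an absolutely continuous Stieltjes measure.
    In the inductive step, consider the closed set [E] of points where the function
    is uniformly approximated, up to [e], by a fixed rational linear form in the
    former coordinates; at almost every point of [E] the distance to [E] has
    derivative zero along the new axis, which makes the approximation joint. *)

(** * Lipschitz functions on the real line *)

Lemma continuous_of_lipschitz (R : realType) (V W : normedModType R) (f : V -> W)
  (L : R) :
  (forall x y, `|f x - f y| <= L * `|x - y|) -> continuous f.
Proof.
move=> fL x; apply/cvgrPdist_lt => e e0.
have L0 : 0 < `|L| + 1 by rewrite ltr_wpDl.
near=> y.
apply: le_lt_trans (fL _ _) _.
apply: (@le_lt_trans _ _ ((`|L| + 1) * `|x - y|)).
  by rewrite ler_wpM2r// (le_trans (ler_norm _))// lerDl.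
rewrite -ltr_pdivlMl//.
by near: y; apply: cvgr_dist_lt => //; rewrite mulr_gt0// invr_gt0.
Unshelve. all: by end_near. Qed.

(** Both [G] and [K1 * x - G x] are nondecreasing and continuous, and their Stieltjes measures add
    up to [K1] times Lebesgue measure. So the measure of [G] is dominated by Lebesgue measure, and
    the Radon-Nikodym theorem provides the density. *)
Lemma nondecreasing_lipschitz_density (R : realType) (G : R -> R) (K a b : R) :
  {homo G : x y / x <= y} ->
  (forall x y, `|G x - G y| <= K * `|x - y|) -> a <= b ->
  exists f : R -> R, [/\ forall x, 0 <= f x,
    (@lebesgue_measure R).-integrable setT (EFin \o f) &
    forall x y, a <= x -> x <= y -> y <= b ->
      (G y - G x)%:E = (\int[lebesgue_measure]_(t in `]x, y]) (f t)%:E)%E].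
Proof.
move=> Gnd GK ab.
pose K1 : R := `|K| + 1.
have K10 : 0 < K1 by rewrite ltr_wpDl.
have GK1 x y : `|G x - G y| <= K1 * `|x - y|.
  apply: le_trans (GK _ _) _.
  by rewrite ler_wpM2r// (le_trans (ler_norm _))// lerDl.
pose H (x : R) : R := K1 * x - G x.
have Hnd : {homo H : x y / x <= y}.
  move=> x y xy; have := GK1 y x; rewrite !ger0_norm ?subr_ge0//; last exact: Gnd.
  by rewrite /H mulrBr; lra.
have Gc : right_continuous G.
  by apply: right_continuousW; exact: continuous_of_lipschitz GK.
have Hc : right_continuous H.
  apply: right_continuousW => x; apply: cvgB;
    last exact: (continuous_of_lipschitz _ _ _ _ _ GK).
  by apply: cvgM; [exact: cvg_cst|exact: cvg_id].
pose Gcu : cumulative R R := HB.pack G (isCumulative.Build R _ R G Gnd Gc).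
pose Hcu : cumulative R R := HB.pack H (isCumulative.Build R _ R H Hnd Hc).
pose nu := lebesgue_stieltjes_measure Gcu.
pose nuH := lebesgue_stieltjes_measure Hcu.
have nuoc (F : cumulative R R) x y : x <= y ->
    lebesgue_stieltjes_measure F `]x, y] = (F y - F x)%:E.
  move=> xy; rewrite /lebesgue_stieltjes_measure/= /measure_extension.
  rewrite measurable_mu_extE/=; last exact: is_ocitv.
  by rewrite wlength_itv_bnd.
have K1i : 0 <= K1^-1 by rewrite invr_ge0 ltW.
pose c : {nonneg R} := NngNum K1i.
pose mu_ := mscale c (measure_add nu nuH).
have muE A : mu_ A = (K1^-1%:E * (nu A + nuH A))%E.
  by rewrite /mu_ /mscale; congr (_ * _)%E; exact: measure_addE.
have lebE A : measurable A -> (@lebesgue_measure R) A = mu_ A.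
  apply: (@lebesgue_measure_unique R mu_) => X.
  move=> /ocitvP[->|[[x y] /= xy ->]]; first by rewrite !measure0.
  have xy' := ltW xy.
  rewrite [RHS]muE /nu /nuH !nuoc//= lebesgue_measure_itv/= lte_fin xy.
  rewrite -!EFinD -EFinM; congr EFin; rewrite /H /=.
  by field; rewrite gt_eqF.
have nudom : nu `<< (@lebesgue_measure R).
  apply/null_content_dominatesP => A mA A0; have /esym/eqP := lebE A mA.
  rewrite [X in _ == X](_ : _ = 0%E)// muE.
  rewrite mule_eq0 /= eqe invr_eq0 gt_eqF//= padde_eq0// => /andP[/eqP + _].
  by [].
have mD : measurable (`]a, b]%classic :
  set (measurableTypeR R)) by exact: measurable_itv.
have nuD : (nu (`]a, b]%classic :
  set (measurableTypeR R)) < +oo)%E by rewrite /nu nuoc// ltry.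
(* Restricting to []a, b]] makes the measure finite, hence its density integrable. *)
pose nuab := mfrestr mD nuD.
have [|h [h0 hfin hint hE]] := @radon_nikodym_sigma_finite _ _ R (@lebesgue_measure
  R) nuab.
  apply/null_content_dominatesP => A mA A0.
  move/null_content_dominatesP : nudom => nudom.
  apply: subset_measure0 (nudom A mA A0) => //; exact: measurableI.
have fE : EFin \o (fine \o h) = h by apply/funext => x /=; rewrite fineK.
exists (fine \o h); split.
- by move=> x; rewrite fine_ge0.
- by rewrite fE.
- move=> x y ax xy yb.
  rewrite (_ : (fun t => _) = h); last by rewrite -[RHS]fE.
  rewrite -hE// -(nuoc Gcu)//.
  rewrite /nuab /mfrestr /mrestr /=; congr (lebesgue_stieltjes_measure _ _).
  rewrite eqEsubset; split => z /=; rewrite !in_itv/=; last by case.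
  move=> /andP[xz zy]; split; first by rewrite xz zy.
  by rewrite (le_lt_trans ax)// (le_trans zy).
Qed.

(** The derivative as an explicit estimate that names its value, so that sums and local changes of
    the function are handled without limits. *)
Definition has_slope (R : realType) (g : R -> R) (x c : R) :=
  forall e, 0 < e -> exists2 r, 0 < r &
    forall h, `|h| < r -> `|g (x + h) - g x - c * h| <= e * `|h|.

Lemma derivable_has_slope (R : realType) (g : R -> R) (x : R) :
  derivable g x 1 -> has_slope _ g x (derive1 g x).
Proof.
move=> dg e e0.
have /cvgrPdist_lt /(_ e e0) : h^-1 *: (g (h + x) - g x) @[h --> 0^'] --> derive1 g x.
  rewrite derive1E /derive; set D := lim _.
  rewrite (_ : (fun h => _) = fun h => h^-1 *: ((g \o shift x) (h *: 1) - g x)).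
    exact: dg.
  by apply/funext => h /=; rewrite [h *: 1]mulr1.
rewrite near_withinE => /nbhs_ballP[r /= r0 rP].
exists r => // h hr.
have [->|h0] := eqVneq h 0; first by rewrite addr0 mulr0 !subrr normr0 mulr0.
have := rP h; rewrite /ball /= sub0r normrN => /(_ hr h0) /ltW.
rewrite -(ler_pM2l (_ : 0 < `|h|)) ?normr_gt0// -normrM [X in _ <= X -> _]mulrC.
rewrite mulrBr /GRing.scale /= mulrA divff// mul1r distrC addrC.
by move=> H; apply: le_trans H; rewrite le_eqVlt; apply/orP; left; apply/eqP;
  congr `|_|; rewrite ?(addrC h x); ring.
Qed.

Lemma has_slopeD (R : realType) (g k : R -> R) (x c d : R) :
  has_slope _ g x c -> has_slope _ k x d -> has_slope _ (g \+ k) x (c + d).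
Proof.
move=> gc kd e e0.
have [r r0 rP] := gc _ (divr_gt0 e0 (ltr0Sn _ 1)).
have [s s0 sP] := kd _ (divr_gt0 e0 (ltr0Sn _ 1)).
exists (Num.min r s) => [|h]; first by rewrite lt_min r0.
rewrite lt_min => /andP[hr hs] /=.
have := lerD (rP _ hr) (sP _ hs); rewrite -mulrDl -splitr; apply: le_trans.
apply: le_trans (ler_normD _ _); rewrite le_eqVlt; apply/orP; left; apply/eqP;
  congr `|_|; rewrite ?(addrC h x); ring.
Qed.

Lemma has_slope_linear (R : realType) (c x : R) : has_slope _ ( *%R c) x c.
Proof.
by move=> e e0; exists 1 => // h _;
  rewrite mulrDr (addrC (c * x)) addrK subrr normr0 mulr_ge0// ltW.
Qed.

Lemma has_slope_near (R : realType) (g k : R -> R) (a b d x c : R) : a < x < b ->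
  (forall y, a < y < b -> g y = k y + d) -> has_slope _ k x c -> has_slope _ g x c.
Proof.
move=> axb gk kc e e0; have [r r0 rP] := kc e e0.
have /andP[ax xb] := axb.
exists (Num.min r (Num.min (x - a) (b - x))) => [|h].
  by rewrite !lt_min r0 !subr_gt0.
rewrite !lt_min => /and3P[hr ha hb]; rewrite !gk//.
  rewrite [y in `|y|](_ : _ = k (x + h) - k x - c * h); last by ring.
  exact: rP.
by move: ha hb; rewrite !ltr_norml => /andP[? ?] /andP[? ?]; lra.
Qed.

(** Adding [L * x] makes [g] nondecreasing, so that it has a density [f]. By Lebesgue's
    differentiation theorem the sum has slope [f x] at almost every [x], and the slope of [g] is
    smaller by [L]. *)
Lemma lipschitz_slope_density (R : realType) (g : R -> R) (L a b : R) :
  (forall x y, `|g x - g y| <= L * `|x - y|) -> a <= b ->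
  exists f : R -> R, [/\ forall x, 0 <= f x,
    (@lebesgue_measure R).-integrable setT (EFin \o f),
    (g b - g a + L * (b - a))%:E = (\int[lebesgue_measure]_(t in `]a, b]) (f t)%:E)%E &
    {ae lebesgue_measure, forall x, a < x < b -> has_slope _ g x (f x - L)}].
Proof.
move=> gL ab; pose G : R -> R := g \+ *%R L.
have Gnd : {homo G : x y / x <= y}.
  move=> x y xy; have := gL x y; rewrite ler_norml distrC ger0_norm ?subr_ge0//.
  by rewrite /G /= => /andP[_]; lra.
have GL x y : `|G x - G y| <= (2 * `|L|) * `|x - y|.
  rewrite /G /= [z in `|z|](_ : _ = (g x - g y) + L * (x - y)); last by ring.
  rewrite (le_trans (ler_normD _ _))// mulr2n mulrDl mul1r mulrDl lerD//.
    by rewrite (le_trans (gL _ _))// ler_wpM2r// ler_norm.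
  by rewrite normrM.
have [f [f0 fint fE]] := nondecreasing_lipschitz_density _ _ _ _ _ Gnd GL ab.
exists f; split => //.
  by rewrite -fE//; congr EFin; rewrite /G /=; ring.
have fintS (D : set R) : measurable D -> lebesgue_measure.-integrable D (EFin \o f).
  by move=> mD; apply: integrableS fint.
(* This primitive starts at minus infinity, as in [FTC1Ny]; on [[a, b]] it differs from [G] by a
   constant, which does not affect slopes. *)
pose F y := (\int[lebesgue_measure]_(t in [set` `]-oo, y]]) (f t))%R.
have FE x y : a <= x -> x <= y -> y <= b -> G y - G x = F y - F x.
  move=> ax xy yb; rewrite /F Rintegral_itvB ?bnd_simp//; last exact: fintS.
  by rewrite /Rintegral -fE.
have := @FTC1Ny R f (fun y => fintS _ (measurable_itv _)).
move=> /(_ (open_integrable_locally openT fint)).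
apply: filterS; first exact: (ae_filter_ringOfSetsType lebesgue_measure).
move=> x /= [dF Fx] axb.
rewrite -(Fx : derive1 F x = f x).
have GF : has_slope _ G x (derive1 F x).
  apply: (@has_slope_near _ G F a b (G a - F a)) (derivable_has_slope _ _ _ dF) => // y.
  by move=> /andP[/ltW ay /ltW yb]; have := FE a y (lexx _) ay yb; lra.
rewrite -mulN1r -[L]mulr1 mulrCA mulN1r mulrN1.
have := has_slopeD _ _ _ _ _ _ GF (has_slope_linear _ (- L) x).
apply: (has_slope_near _ _ _ a b 0) => // y _.
by rewrite /G /=; ring.
Qed.

Lemma lipschitz_ae_slope (R : realType) (g : R -> R) (L : R) :
  (forall x y, `|g x - g y| <= L * `|x - y|) ->
  {ae lebesgue_measure, forall x, exists c, has_slope _ g x c}.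
Proof.
move=> gL.
have : {ae lebesgue_measure, forall x : R, forall n : nat,
    - n%:R < x < n%:R -> exists c, has_slope _ g x c}.
  apply: ae_foralln => n.
  have [|f [_ _ _]] := lipschitz_slope_density _ _ _ (- n%:R) n%:R gL.
    by rewrite lerNl (le_trans _ (ler0n _ _))// oppr_le0.
  apply: filterS; first exact: (ae_filter_ringOfSetsType lebesgue_measure).
  by move=> x fx /fx ?; eexists; eassumption.
apply: filterS; first exact: (ae_filter_ringOfSetsType lebesgue_measure).
move=> x /(_ (Num.bound `|x|)); apply.
by rewrite -ltr_norml archi_boundP.
Qed.

(** If no slope found outside [N] exceeded [al], the density of [g] shifted by [L'] would be at most
    [be + L'] almost everywhere, and integrating it would contradict the increment. *)
Lemma lipschitz_mean_value (R : realType) (g : R -> R) (L a b al : R) (N : set R) :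
  (forall x y, `|g x - g y| <= L * `|x - y|) -> a < b ->
  al * (b - a) < g b - g a -> lebesgue_measure.-negligible N ->
  exists x c, [/\ a < x < b, ~ N x, has_slope _ g x c & al < c].
Proof.
move=> gL0 ab alab N0; pose L' := L + 1.
have gL x y : `|g x - g y| <= L' * `|x - y|.
  by rewrite (le_trans (gL0 _ _))// ler_wpM2r// lerDl.
(* The maximum keeps [be + L'] nonnegative, as the comparison of nonnegative integrals requires.
   Taking [L' = L + 1] keeps the gap strict when the maximum is [- L']. *)
pose be := Num.max al (- L').
have ba : 0 < b - a by rewrite subr_gt0.
have beab : be * (b - a) < g b - g a.
  have LE : - (L * (b - a)) <= g b - g a.
    by have := gL0 b a; rewrite ler_norml (gtr0_norm ba) => /andP[].
  by rewrite /be /Num.max; case: ifP => // _; rewrite /L'; lra.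
apply: contrapT => H.
have [f [f0 fint fE fae]] := lipschitz_slope_density _ _ _ _ _ gL (ltW ab).
have fintS : lebesgue_measure.-integrable `]a, b[%classic (EFin \o f).
  exact: integrableS fint.
have mf := measurable_int _ fintS.
have be0 : 0 <= be + L' by rewrite -lerBlDr sub0r /be le_max lexx orbT.
have : (\int[lebesgue_measure]_(t in `]a, b[) (f t)%:E <=
        \int[lebesgue_measure]_(t in `]a, b[) (cst (be + L')%:E) t)%E.
  apply: ae_ge0_le_integral => //.
  - by move=> x _; rewrite lee_fin.
  have /negligibleU := fae => /(_ _ N0).
  apply: negligibleS => x /= /not_implyP[]; rewrite in_itv/= => axb fx.
  apply: contrapT => /not_orP[/contrapT fs Nx]; apply: fx.
  rewrite leNgt; apply/negP; rewrite lte_fin => fx; apply: H.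
  exists x, (f x - L'); split => //; first exact: fs.
  by rewrite ltrBrDr (le_lt_trans _ fx)// lerD2r /be le_max lexx.
rewrite integral_itv_bndo_bndc//.
rewrite -fE integral_cst//= lebesgue_measure_itv/= lte_fin ab -EFinB -EFinM lee_fin.
by lra.
Qed.

(** * Fubini's theorem on parametrized affine subspaces *)

Definition set_dist (R : realType) (V : normedModType R) (A : set V) (x : V) : R :=
  inf [set `|x - y| | y in A].

Lemma set_dist_has_inf (R : realType) (V : normedModType R) (A : set V) (x : V) :
  A !=set0 -> has_inf [set `|x - y| | y in A].
Proof.
by move=> [a Aa]; split; [exists `|x - a|, a|exists 0 => _ [y _ <-]].
Qed.

Lemma set_dist_le (R : realType) (V : normedModType R) (A : set V) (x y : V) :
  A y -> set_dist R V A x <= `|x - y|.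
Proof.
move=> Ay; apply: ge_inf; last by exists y.
by exists 0 => _ [z _ <-].
Qed.

Lemma set_dist_lt (R : realType) (V : normedModType R) (A : set V) (x : V) (e : R) :
  A !=set0 -> set_dist R V A x < e -> exists2 y, A y & `|x - y| < e.
Proof.
move=> A0 dx; have := inf_adherent (_ :
  0 < e - set_dist R V A x) (set_dist_has_inf R V A x A0).
rewrite subr_gt0 => /(_ dx)[_ [y Ay <-]].
by move=> H; exists y => //; move: H; rewrite /set_dist; lra.
Qed.

Lemma set_dist_lipschitz (R : realType) (V : normedModType R) (A : set V) (x y : V) :
  A !=set0 -> `|set_dist R V A x - set_dist R V A y| <= 1 * `|x - y|.
Proof.
move=> A0; rewrite mul1r.
have H u v : set_dist R V A u - set_dist R V A v <= `|u - v|.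
  rewrite lerBlDr; apply/ler_addgt0Pr => e e0.
  have [|w Aw vw] := @set_dist_lt R V A v (set_dist R V A v + e) A0;
    first by rewrite ltrDl.
  rewrite (le_trans (set_dist_le R V A u w Aw))// -(subrK v u) -addrA.
  by rewrite (le_trans (ler_normD _ _))// subrK -addrA lerD2l ltW.
by rewrite ler_norml H andbT lerNl opprB distrC H.
Qed.

Lemma closed_set_dist (R : realType) (V : normedModType R) (A : set V) :
  closed A -> A !=set0 -> A = [set x | set_dist R V A x <= 0].
Proof.
move=> cA A0; rewrite eqEsubset; split => x /=.
  by move=> Ax; rewrite (le_trans (set_dist_le R V A x x Ax))// subrr normr0.
move=> dx; apply: cA => B /nbhs_ballP[e /= e0 eB].
have [|y Ay xy] := @set_dist_lt R V A x e A0; first exact: le_lt_trans e0.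
by exists y; split => //; apply: eB; rewrite -ball_normE.
Qed.

(** Borel measurability tested on continuous real functions, so that [V] needs no sigma-algebra. *)
Definition borel_param (R : realType) d (T : measurableType d) (V : normedModType R)
    (phi : T -> V) :=
  forall F : V -> R, continuous F -> measurable_fun setT (F \o phi).

(** A nonempty closed set is a sublevel set of its distance function, which is continuous. *)
Lemma borel_param_closed (R : realType) d (T : measurableType d)
    (V : normedModType R) (phi : T -> V) (A : set V) :
  borel_param R d T V phi -> closed A -> measurable (phi @^-1` A).
Proof.
move=> mphi cA; have [->|A0] := eqVneq A set0; first by rewrite preimage_set0.
move/set0P : A0 => A0.
have cd : continuous (set_dist R V A).
  by apply: continuous_of_lipschitz => x y; exact: set_dist_lipschitz.
have := mphi _ cd measurableT _ (measurable_itv `]-oo, 0]%R).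
rewrite setTI; congr (measurable _).
by rewrite [in RHS](closed_set_dist R V A cA A0) /preimage; apply/seteqP;
  split => t /=; rewrite in_itv.
Qed.

(* [(t, s) |-> F (phi t + s e)] is measurable in [t] and continuous in [s]:
   it is the limit of its discretizations in [s]. *)
Lemma borel_paramD (R : realType) d (T : measurableType d)
    (V : normedModType R) (phi : T -> V) (e : V) :
  borel_param R d T V phi ->
  borel_param R _ (T * measurableTypeR R)%type V (fun z => phi z.1 + z.2 *: e).
Proof.
move=> mphi F cF.
pose q (k : nat) (s : R) : R := (Num.floor (k.+1%:R * s))%:~R / k.+1%:R.
have k0 (k : nat) : 0 < k.+1%:R :> R by rewrite ltr0Sn.
have qs k s : `|s - q k s| <= k.+1%:R^-1.
  have /andP[] := floor_itv (k.+1%:R * s); rewrite intrD.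
  set z := (_%:~R) => zs sz.
  have -> : s - q k s = (k.+1%:R * s - z) / k.+1%:R.
    by rewrite /q -/z; field; rewrite gt_eqF.
  rewrite normrM (gtr0_norm (_ : 0 < k.+1%:R^-1)) ?invr_gt0// ler_piMl ?invr_ge0//.
  by rewrite ler_norml; lra.
apply: (@measurable_realfun.measurable_fun_cvg _ _ R setT
  (fun k z => F (phi z.1 + q k z.2 *: e))).
- move=> k _ Y mY; rewrite setTI.
  (* Where the floor has the value [j], the shift is constant and [s] ranges over a half-open
     interval; the preimage is a countable union of rectangles. *)
  rewrite (_ : _ @^-1` _ = \bigcup_(j : int)
    (((fun t => F (phi t + (j%:~R / k.+1%:R) *: e)) @^-1` Y) `*`
     [set s : measurableTypeR R | Num.floor (k.+1%:R * s) = j])).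
    apply: countable_bigcupT_measurable; first exact: countableP.
    move=> j; apply: measurableX.
      have := mphi (fun x => F (x + (j%:~R / k.+1%:R) *: e)) _ measurableT Y mY.
      rewrite setTI; apply.
      move=> x; apply: continuous_comp; last exact: cF.
      by apply: cvgD; [exact: cvg_id|exact: cvg_cst].
    rewrite (_ : [set _ | _] = `[j%:~R / k.+1%:R, (j + 1)%:~R / k.+1%:R[%classic);
      first exact: measurable_itv.
    apply/seteqP; split => s /=; rewrite in_itv/= ler_pdivrMr// ltr_pdivlMr// mulrC.
      by move=> <-; exact: floor_itv.
    exact: floor_def.
  apply/seteqP; split => [[t s] /= Ys|[t s] [j _ [/= Ys sj]]]; last by rewrite /= /q sj.
  by exists (Num.floor (k.+1%:R * s)).
- move=> [t s] _ /=.
  apply: continuous_cvg; first exact: cF.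
  apply: cvgD; first exact: cvg_cst.
  apply: cvgZr_tmp.
  apply/cvgrPdist_le => r r0; near=> k.
  apply: le_trans (qs _ _) _.
  near: k; have := @cvg_harmonic R => /cvgrPdist_le/(_ r r0).
  by apply: filterS => k; rewrite /harmonic sub0r normrN ger0_norm// invr_ge0.
Unshelve. all: by end_near. Qed.

Lemma product_measure_null_xsection (R : realType) d1 d2 (T1 : measurableType d1)
    (T2 : measurableType d2) (m1 : {sigma_finite_measure set T1 -> \bar R})
    (m2 : {sigma_finite_measure set T2 -> \bar R}) (B : set (T1 * T2)) :
  (forall x, m2 (xsection B x) = 0%E) -> (m1 \x m2)%E B = 0%E.
Proof. by move=> B0; apply: integral0_eq => x _ /=. Qed.

(** The product measure integrates measures of [x]-sections; its uniqueness on measurable sets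
    permits the other order of integration. *)
Lemma product_measure_null_ysection (R : realType) d1 d2 (T1 : measurableType d1)
    (T2 : measurableType d2) (m1 : {sigma_finite_measure set T1 -> \bar R})
    (m2 : {sigma_finite_measure set T2 -> \bar R}) (B : set (T1 * T2)) :
  measurable B -> (forall y, m1 (ysection B y) = 0%E) -> (m1 \x m2)%E B = 0%E.
Proof.
move=> mB B0; rewrite (@product_measure_unique _ _ _ _ _ m1 m2 (m1 \x^ m2)%E)//.
  by apply: integral0_eq => x _ /=.
exact: product_measure2E.
Qed.

(** * Rademacher's theorem *)

Lemma differentiable_expansion (R : realType) (V W : normedModType R) (f : V -> W)
    (x : V) : differentiable f x ->
  forall e, 0 < e -> exists2 r, 0 < r &
    forall h, `|h| < r -> `|f (x + h) - f x - 'd f x h| <= e * `|h|.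
Proof.
move=> /diff_locally df e e0.
move: df => /eqaddoP/(_ e e0)/nbhs_ballP[r /= r0 rP].
exists r => // h hr; have := rP h; rewrite -ball_normE /ball_/= sub0r normrN.
by move=> /(_ hr) /=; rewrite !fctE/= opprD addrA (addrC h).
Qed.

Lemma expansion_differentiable (R : realType) (V W : normedModType R) (f : V -> W)
    (df : {linear V -> W}) (x : V) : continuous df ->
  (forall e, 0 < e -> exists2 r, 0 < r &
    forall h, `|h| < r -> `|f (x + h) - f x - df h| <= e * `|h|) ->
  differentiable f x /\ 'd f x = df :> (V -> W).
Proof.
move=> cdf H.
have fo : f \o shift x = cst (f x) + df +o_0 id.
  apply/eqaddoP => e e0; have [r r0 rP] := H e e0.
  apply/nbhs_ballP; exists r => //= h; rewrite -ball_normE /ball_/= sub0r normrN.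
  by move=> /rP; rewrite !fctE/= opprD addrA (addrC h).
have E := diff_unique cdf fo.
split; last by rewrite E.
by apply/diff_locallyP; rewrite E.
Qed.

Lemma le_entry_mx_norm (R : realType) (m n : nat) (A : 'M[R]_(m, n)) i j :
  `|A i j| <= `|A|.
Proof.
rewrite {2}/Num.norm/= mx_normrE.
exact: (@le_bigmax _ _ _ 0 (fun ij => `|A ij.1 ij.2|) (i, j)).
Qed.

Lemma mx_norm_le (R : realType) (m n : nat) (A : 'M[R]_(m, n)) (e : R) :
  0 <= e -> (forall i j, `|A i j| <= e) -> `|A| <= e.
Proof.
move=> e0 Ae; rewrite {1}/Num.norm/= mx_normrE.
by apply: bigmax_le => // -[i j] _; exact: Ae.
Qed.

Lemma frob_le (R : realType) (m n : nat) (A B : 'M[R]_(m, n)) (e : R) :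
  (forall i j, `|A i j| <= e) -> `|frob A B| <= (m * n)%:R * e * `|B|.
Proof.
move=> Ae; rewrite frobE.
apply: le_trans (ler_norm_sum _ _ _) _.
apply: (@le_trans _ _ (\sum_(i < m) \sum_(j < n) (e * `|B|))).
  apply: ler_sum => i _; apply: le_trans (ler_norm_sum _ _ _) _.
  apply: ler_sum => j _; rewrite normrM ler_pM//; exact: le_entry_mx_norm.
by rewrite sumr_const sumr_const !card_ord -mulrnA -[X in X <= _]mulr_natl mulrA mulnC.
Qed.

Lemma frobDl (R : realType) (m n : nat) (A B C : 'M[R]_(m, n)) :
  frob (A + B) C = frob A C + frob B C.
Proof. by rewrite /frob linearD/= mulmxDl linearD. Qed.

Lemma frobDr (R : realType) (m n : nat) (A B C : 'M[R]_(m, n)) :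
  frob A (B + C) = frob A B + frob A C.
Proof. by rewrite /frob mulmxDr linearD. Qed.

Lemma frobZl (R : realType) (m n : nat) (a : R) (A B : 'M[R]_(m, n)) :
  frob (a *: A) B = a * frob A B.
Proof. by rewrite /frob linearZ/= -scalemxAl linearZ. Qed.

Lemma frobZr (R : realType) (m n : nat) (a : R) (A B : 'M[R]_(m, n)) :
  frob A (a *: B) = a * frob A B.
Proof. by rewrite /frob -scalemxAr linearZ. Qed.

Lemma frobNl (R : realType) (m n : nat) (A B : 'M[R]_(m, n)) :
  frob (- A) B = - frob A B.
Proof. by rewrite -scaleN1r frobZl mulN1r. Qed.

Lemma frob_deltal (R : realType) (m n : nat) (A : 'M[R]_(m, n)) i j :
  frob (delta_mx i j) A = A i j.
Proof.
rewrite frobE (bigD1 i)//= (bigD1 j)//= mxE !eqxx mul1r.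
rewrite big1 => [|k kj]; last by rewrite mxE (negbTE kj) andbF mul0r.
rewrite big1 => [|k ki]; first by rewrite !addr0.
by rewrite big1// => l _; rewrite mxE (negbTE ki) mul0r.
Qed.

Lemma frobC (R : realType) (m n : nat) (A B : 'M[R]_(m, n)) : frob A B = frob B A.
Proof. by rewrite !frobE; do 2!apply: eq_bigr => ? _; rewrite mulrC. Qed.

Lemma frob_deltar (R : realType) (m n : nat) (A : 'M[R]_(m, n)) i j :
  frob A (delta_mx i j) = A i j.
Proof. by rewrite frobC frob_deltal. Qed.

Lemma mx_norm_delta_le (R : realType) (m n : nat) (i : 'I_m) (j : 'I_n) :
  `|delta_mx i j : 'M[R]_(m, n)| <= 1.
Proof. by apply: mx_norm_le => // k l; rewrite mxE normr_nat lern1 leq_b1. Qed.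

(** * Differentiability along sets of directions *)

(** Fixing [C], [r] and [e] makes this set closed for continuous [f], as an intersection of closed
    conditions, one for each admissible [h]. *)
Definition lin_approx (R : realType) (m n : nat) (f : 'M[R]_(m, n) -> R)
    (W : set 'M[R]_(m, n)) (C : 'M[R]_(m, n)) (r e : R) : set 'M[R]_(m, n) :=
  [set x | forall h, W h -> `|h| < r -> `|f (x + h) - f x - frob C h| <= e * `|h|].

(* Differentiability at [x] along the directions of [W]. The approximating linear
   form may depend on [e], so that only countably many forms need to be tested. *)
Definition differentiable_along (R : realType) (m n : nat) (f : 'M[R]_(m, n) -> R)
    (W : set 'M[R]_(m, n)) : set 'M[R]_(m, n) :=
  [set x | forall e, 0 < e -> exists C, exists2 r,
    0 < r & lin_approx R m n f W C r e x].

Lemma continuous_comp_addr (R : realType) (V : normedModType R) (W : topologicalType)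
  (f : V -> W) (h : V) : continuous f -> continuous (fun x => f (x + h)).
Proof.
move=> cf x; apply: (@continuous_comp _ _ _ (fun y => y + h) f); last exact: cf.
by apply: cvgD; [exact: cvg_id|exact: cvg_cst].
Qed.

Lemma continuous_increment (R : realType) (V : normedModType R) (f : V -> R)
  (h : V) (c : R) : continuous f -> continuous (fun x => `|f (x + h) - f x - c|).
Proof.
move=> cf x; apply: cvg_norm; apply: cvgB; last exact: cvg_cst.
by apply: cvgB; [exact: continuous_comp_addr|exact: cf].
Qed.

Lemma closed_lin_approx (R : realType) (m n : nat) (f : 'M[R]_(m, n) -> R) W C r e :
  continuous f -> closed (lin_approx R m n f W C r e).
Proof.
move=> cf.
rewrite (_ : lin_approx _ _ _ _ _ _ _ _ = \bigcap_(h in [set h | W h /\ `|h| < r])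
   [set x | `|f (x + h) - f x - frob C h| <= e * `|h|]); last first.
  apply/seteqP; split => x /= H h; first by case; exact: H.
  by move=> Wh hr; exact: H.
apply: closed_bigI => h _.
suff /continuous_closedP/(_ _ (@closed_le _ (e * `|h|))) :
  continuous (fun x : 'M[R]_(m, n) => `|f (x + h) - f x - frob C h|) by [].
exact: continuous_increment.
Qed.

Lemma lin_approx_le (R : realType) (m n : nat) (f : 'M[R]_(m, n) -> R) W C r r' e e' :
  r' <= r -> e <= e' -> lin_approx R m n f W C r e `<=` lin_approx R m n f W C r' e'.
Proof.
move=> rr ee x H h Wh hr; rewrite (le_trans (H h Wh (lt_le_trans hr rr)))//.
by rewrite ler_wpM2r.
Qed.

Lemma lin_approx_form (R : realType) (m n : nat) (f : 'M[R]_(m, n) -> R) W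
  (C C' : 'M[R]_(m, n)) (r e e' : R) :
  (forall i j, `|C i j - C' i j| <= e') ->
  lin_approx R m n f W C r e `<=` lin_approx R m n f W C' r (e + (m * n)%:R * e').
Proof.
move=> CC x H h Wh hr.
have -> : f (x + h) - f x - frob C' h = (f (x + h) - f x - frob C h) + frob (C - C') h.
  by rewrite frobDl frobNl; ring.
rewrite (le_trans (ler_normD _ _))// mulrDl lerD ?H// frob_le// => i j.
by rewrite !mxE.
Qed.

Definition rat_mx (R : realType) (m n : nat) (C : 'M[rat]_(m, n)) : 'M[R]_(m, n) :=
  map_mx ratr C.

Lemma rat_mx_dense (R : realType) (m n : nat) (C : 'M[R]_(m, n)) (e : R) : 0 < e ->
  exists D : 'M[rat]_(m, n), forall i j, `|C i j - rat_mx R m n D i j| <= e.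
Proof.
move=> e0.
have /choice[q qP] (ij : 'I_m * 'I_n) : exists q : rat, `|C ij.1 ij.2 - ratr q| <= e.
  have [|q] := @rat_in_itvoo R (C ij.1 ij.2) (C ij.1 ij.2 + e); first by rewrite ltrDl.
  rewrite in_itv/= => /andP[? ?]; exists q; rewrite ler_norml; lra.
exists (\matrix_(i, j) q (i, j)) => i j; rewrite !mxE; exact: (qP (i, j)).
Qed.

(** Rounding the form to a rational one costs arbitrarily little, and radii and errors may be taken
    among the [1 / (k + 1)]. The set thus becomes a countable combination of closed sets, whence its
    measurability. *)
Lemma differentiable_along_rat (R : realType) (m n : nat) (f : 'M[R]_(m, n) -> R) W :
  differentiable_along R m n f W = \bigcap_(i : nat)
    \bigcup_(C : 'M[rat]_(m, n)) \bigcup_(j : nat)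
      lin_approx R m n f W (rat_mx R m n C) j.+1%:R^-1 i.+1%:R^-1.
Proof.
apply/seteqP; split => x H.
  move=> i _; have i0 : 0 < i.+1%:R^-1 :> R by rewrite invr_gt0 ltr0Sn.
  have [C [r r0 Cr]] := H _ (divr_gt0 i0 (ltr0Sn _ 1)).
  (* Half of the error is spent on [C], the other half on rounding, whose cost is multiplied by
     [m * n]. *)
  pose e' : R := i.+1%:R^-1 / 2 / (m * n).+1%:R.
  have e'0 : 0 < e' by rewrite !divr_gt0// ltr0Sn.
  have [D CD] := rat_mx_dense R m n C e' e'0.
  have [j _ jP] := near_infty_natSinv_lt (PosNum r0).
  exists D => //; exists j => //.
  have := lin_approx_form _ _ _ _ _ _ _ _ _ _ CD x Cr.
  apply: lin_approx_le; first by apply: ltW; apply: jP => /=.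
  rewrite [leRHS]splitr lerD2l /e' mulrCA ger_pMr ?divr_gt0//.
  by rewrite ler_pdivrMr ?ltr0Sn// mul1r ler_nat.
move=> e e0; have [i _ iP] := near_infty_natSinv_lt (PosNum e0).
have [C _ [j _ jP]] := H i I.
exists (rat_mx R m n C), j.+1%:R^-1; first by rewrite invr_gt0 ltr0Sn.
by apply: lin_approx_le jP => //; apply: ltW; apply: iP => /=.
Qed.

Lemma measurable_differentiable_along (R : realType) d (T : measurableType d)
    (m n : nat) (phi : T -> 'M[R]_(m, n)) f W :
  borel_param R d T _ phi -> continuous f ->
  measurable (phi @^-1` differentiable_along R m n f W).
Proof.
move=> mphi cf; rewrite differentiable_along_rat preimage_bigcap.
apply: bigcapT_measurable => i; rewrite preimage_bigcup.
apply: countable_bigcupT_measurable; first exact: countableP.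
move=> C; rewrite preimage_bigcup; apply: bigcupT_measurable => j.
by apply: borel_param_closed => //; exact: closed_lin_approx.
Qed.

Definition mx_support (R : realType) (m n : nat) (S : seq ('I_m * 'I_n)) :
    set 'M[R]_(m, n) :=
  [set h | forall i j, (i, j) \notin S -> h i j = 0].

Definition mx_axis (R : realType) (m n : nat) (i : 'I_m) (j : 'I_n) :
    set 'M[R]_(m, n) :=
  [set s *: delta_mx i j | s in setT].

Lemma mx_axis_norm_ge (R : realType) (m n : nat) (i : 'I_m) (j : 'I_n) (s : R) :
  `|s| <= `|s *: (delta_mx i j : 'M[R]_(m, n))|.
Proof.
by have := le_entry_mx_norm R m n (s *: delta_mx i j) i j; rewrite !mxE !eqxx mulr1.
Qed.

Lemma mx_axis_norm_le (R : realType) (m n : nat) (i : 'I_m) (j : 'I_n) (s : R) :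
  `|s *: (delta_mx i j : 'M[R]_(m, n))| <= `|s|.
Proof. by rewrite normrZ ler_piMr// mx_norm_delta_le. Qed.

Lemma has_slope_axis (R : realType) (m n : nat) (f : 'M[R]_(m, n) -> R) (i : 'I_m)
    (j : 'I_n) (x : 'M[R]_(m, n)) (s c : R) :
  has_slope R (fun s => f (x + s *: delta_mx i j)) s c ->
  differentiable_along R m n f (mx_axis R m n i j) (x + s *: delta_mx i j).
Proof.
move=> fc e e0; have [r r0 rP] := fc e e0.
exists (c *: delta_mx i j), r => // _ [u _ <-] ur.
rewrite frobZl frobZr frob_deltal mxE !eqxx mulr1 -[x + _ + _]addrA -scalerDl.
have ur' := le_lt_trans (mx_axis_norm_ge R m n i j u) ur.
apply: le_trans (rP _ ur') _; rewrite ler_wpM2l ?(ltW e0)//; exact: mx_axis_norm_ge.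
Qed.

Lemma axis_slope (R : realType) (m n : nat) (f : 'M[R]_(m, n) -> R) (i : 'I_m)
    (j : 'I_n) (x : 'M[R]_(m, n)) (e : R) :
  differentiable_along R m n f (mx_axis R m n i j) x -> 0 < e ->
  exists c, exists2 r, 0 < r & forall s, `|s| < r ->
    `|f (x + s *: delta_mx i j) - f x - c * s| <= e * `|s|.
Proof.
move=> fx e0; have [C [r r0 rP]] := fx e e0.
exists (C i j), r => // s sr.
have sr' := le_lt_trans (mx_axis_norm_le R m n i j s) sr.
have := rP _ (ex_intro2 _ _ s I erefl) sr'.
rewrite frobZr frob_deltar (mulrC s) => /le_trans; apply.
by rewrite ler_wpM2l ?(ltW e0)// mx_axis_norm_le.
Qed.

Lemma lipschitz_axis_negligible (R : realType) (m n : nat) (f : 'M[R]_(m, n) -> R)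
    (L : R) (i : 'I_m) (j : 'I_n) (x : 'M[R]_(m, n)) :
  (forall x y, `|f x - f y| <= L * `|x - y|) ->
  (@lebesgue_measure R).-negligible
    [set s | ~ differentiable_along R m n f (mx_axis R m n i j) (x + s *: delta_mx i
      j)].
Proof.
move=> fL; have := @lipschitz_ae_slope R (fun s => f (x + s *: delta_mx i j)) `|L|.
have H s t : `|f (x + s *: delta_mx i j) - f (x + t *: delta_mx i j)| <= `|L| * `|s -
  t|.
  rewrite (le_trans (fL _ _))// opprD addrACA subrr add0r -scalerBl.
  rewrite (le_trans (ler_norm _))// normrM normr_id ler_wpM2l//.
  exact: mx_axis_norm_le.
move=> /(_ H); apply: negligibleS => s /= Hs; apply: contra_not Hs => -[c].
exact: has_slope_axis.
Qed.

(** Collects the four errors on the path [x + h], [y + h'], [y], [x + s *: D], [x] followed in the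
    next proof, where [p] and [q] are the linear increments of the second and fourth legs. *)
Lemma telescope_le (R : realType) (a b c d g p q t : R) :
  `|a - b| <= t -> `|b - c - p| <= t -> `|c - d| <= t -> `|d - g - q| <= t ->
  `|a - g - (p + q)| <= 4 * t.
Proof. by rewrite !ler_norml => /andP[? ?] /andP[? ?] /andP[? ?] /andP[? ?]; lra. Qed.

(* On [E], where [f] is uniformly approximated along the axes of [S], a point at
   which the distance to [E] is differentiable along a further axis is not porous:
   the nearby points on that axis are much closer to [E]. *)
Lemma differentiable_along_cons (R : realType) (m n : nat) (f : 'M[R]_(m, n) -> R)
    (L : R) (i : 'I_m) (j : 'I_n) (S : seq ('I_m * 'I_n)) (x : 'M[R]_(m, n)) :
  (forall x y, `|f x - f y| <= L * `|x - y|) ->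
  differentiable_along R m n f (mx_support R m n S) x ->
  differentiable_along R m n f (mx_axis R m n i j) x ->
  (forall (k l : nat) (C : 'M[rat]_(m, n)),
     let E := lin_approx R m n f (mx_support R m n S) (rat_mx R m n C)
                l.+1%:R^-1 k.+1%:R^-1 in
     E x -> differentiable_along R m n (set_dist R _ E) (mx_axis R m n i j) x) ->
  differentiable_along R m n f (mx_support R m n ((i, j) :: S)) x.
Proof.
move=> fL0 fS fij fE e e0.
pose K := `|L| + 1.
have K0 : 0 < K by rewrite ltr_wpDl.
have fL y z : `|f y - f z| <= K * `|y - z|.
  rewrite (le_trans (fL0 _ _))// ler_wpM2r// (le_trans (ler_norm _))//.
  by rewrite lerDl.
have e40 : 0 < e / 4 by rewrite divr_gt0// ltr0Sn.
move: fS; rewrite differentiable_along_rat => fS.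
have [k _ kP] := near_infty_natSinv_lt (PosNum e40).
have [C _ [l _ Ex]] := fS k I.
have {}kP : k.+1%:R^-1 <= e / 4 by apply: ltW; apply: kP => /=.
have := fE k l C Ex; set E := lin_approx _ _ _ _ _ _ _ _ in Ex *.
have E0 : E !=set0 by exists x.
have dE0 y : 0 <= set_dist R _ E y.
  by apply: lb_le_inf; [case: E0 => z Ez; exists `|y - z|, z|move=> _ [z _ <-]].
have dEx : set_dist R _ E x = 0.
  by apply/eqP; rewrite eq_le dE0 andbT (le_trans (set_dist_le _ _ _ _ x _))//
    subrr normr0.
(* Chosen so that [K * (3 * e2) = e / 4], one of the four errors. *)
pose e2 : R := e / (12%:R * K).
have e20 : 0 < e2 by rewrite divr_gt0// mulr_gt0// ltr0Sn.
move=> /axis_slope/(_ e20)[d [r1 r10 r1P]].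
have [c [r2 r20 r2P]] := axis_slope _ _ _ _ _ _ _ _ fij e40.
pose D := delta_mx i j : 'M[R]_(m, n).
(* The distance to [E] is nonnegative and vanishes at [x]. Adding its expansions at [s] and [- s]
   cancels the slope [d] and bounds it by [2 * e2 * |s|]; the factor 3 leaves room for an infimum
   that is not attained. *)
have near_E (s : R) : `|s| < r1 -> exists2 y, E y & `|x + s *: D - y| <= 3 * e2 * `|s|.
  move=> sr1; have [->|s0] := eqVneq s 0.
    by exists x => //; rewrite scale0r addr0 subrr !normr0 mulr0.
  have s0' : 0 < `|s| by rewrite normr_gt0.
  have [|y Ey ys] := set_dist_lt R _ E (x + s *: D) (3 * e2 * `|s|) E0; last first.
    by exists y => //; exact: ltW.
  have := r1P s sr1; have := r1P (- s); rewrite normrN => /(_ sr1).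
  rewrite dEx !subr0 mulrN !ler_norml; have := dE0 (x + - s *: D).
  set u := set_dist _ _ _ _; set v := set_dist _ _ _ _.
  move=> u0 /andP[_ H1] /andP[_ H2].
  by have := mulr_gt0 e20 s0'; lra.
(* The rational form with its entry at [(i, j)] replaced by the slope [c] along the new axis. *)
exists (rat_mx R m n C + (c - rat_mx R m n C i j) *: D).
exists (Num.min l.+1%:R^-1 (Num.min r1 r2)).
  by rewrite !lt_min r10 r20 invr_gt0 ltr0Sn.
move=> h Sh; rewrite !lt_min => /and3P[hl h1 h2].
(* Removing the entry at [(i, j)] leaves [h'] supported in [S], whether or not [(i, j)] already
   belongs to [S]. *)
pose s := h i j; pose h' := h - s *: D.
have sh : `|s| <= `|h| by exact: le_entry_mx_norm.
have h'E k0 l0 : h' k0 l0 = if (k0 == i) && (l0 == j) then 0 else h k0 l0.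
  rewrite !mxE; case: andP => [[/eqP -> /eqP ->]|_]; first by rewrite mulr1 subrr.
  by rewrite mulr0n mulr0 subr0.
have h'h : `|h'| <= `|h|.
  by apply: mx_norm_le => // k0 l0; rewrite h'E; case: ifP;
    rewrite ?normr0// le_entry_mx_norm.
have Sh' : mx_support R m n S h'.
  move=> k0 l0 kl; rewrite h'E; case: ifP => // /negbT nkl; apply: Sh.
  by rewrite inE negb_or kl andbT xpair_eqE.
have [y Ey ys] := near_E s (le_lt_trans sh h1).
have hE : h = h' + s *: D by rewrite subrK.
have -> : frob (rat_mx R m n C + (c - rat_mx R m n C i j) *: D) h
    = frob (rat_mx R m n C) h' + c * s.
  by rewrite frobDl frobZl frob_deltal {1}hE frobDr frobZr frob_deltar -/s; ring.
have A1 : `|f (x + h) - f (y + h')| <= K * (3 * e2 * `|s|).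
  rewrite (le_trans (fL _ _))// ler_wpM2l ?(ltW K0)//.
  by rewrite hE (addrC h') addrA opprD addrACA subrr addr0.
have A2 := Ey h' Sh' (le_lt_trans h'h hl).
have A3 : `|f y - f (x + s *: D)| <= K * (3 * e2 * `|s|).
  by rewrite (le_trans (fL _ _))// ler_wpM2l ?(ltW K0)// distrC.
have A4 := r2P s (le_lt_trans sh h2).
have Ke2 : K * (3 * e2 * `|s|) <= e / 4 * `|h|.
  have -> : K * (3 * e2 * `|s|) = e / 4 * `|s| by rewrite /e2; field; rewrite gt_eqF.
  by rewrite ler_wpM2l// ltW.
have A2' : k.+1%:R^-1 * `|h'| <= e / 4 * `|h| by rewrite ler_pM// invr_ge0.
have A4' : e / 4 * `|s| <= e / 4 * `|h| by rewrite ler_wpM2l// ltW.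
have -> : e * `|h| = 4 * (e / 4 * `|h|) by field.
exact: telescope_le (le_trans A1 Ke2) (le_trans A2 A2') (le_trans A3 Ke2) (le_trans
  A4 A4').
Qed.

Lemma negligible_bigcup_countable d (T : measurableType d) (R : realType)
    (mu : {measure set T -> \bar R}) (I : countType) (F : I -> set T) :
  (forall i, mu.-negligible (F i)) -> mu.-negligible (\bigcup_i F i).
Proof.
move=> F0.
apply: (@negligibleS _ _ _ _ (\bigcup_(n :
  nat) if unpickle n is Some i then F i else set0)).
  by move=> t [i _ Fit]; exists (pickle i) => //; rewrite pickleK.
by apply: negligible_bigcup => n; case: unpickle => // *; exact: negligible_set0.
Qed.

Lemma borel_param_shift (R : realType) d (T : measurableType d)
    (V : normedModType R) (phi : T -> V) (x : V) :
  borel_param R d T V phi -> borel_param R d T V (fun t => x + phi t).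
Proof.
move=> mphi F cF; apply: (mphi (fun y => F (x + y))).
rewrite (_ : (fun y => F (x + y)) = fun y => F (y + x));
  first exact: continuous_comp_addr.
by apply/funext => y; rewrite addrC.
Qed.

Lemma borel_param_ball (R : realType) d (T : measurableType d)
    (V : normedModType R) (phi : T -> V) (r : R) :
  borel_param R d T V phi -> measurable [set t | `|phi t| < r].
Proof.
move=> mphi.
have := mphi _ (@norm_continuous _ V) measurableT _ (measurable_itv `]-oo, r[%R).
rewrite setTI; congr (measurable _).
Qed.

Lemma sigma_finite_product_measure (R : realType) d1 d2 (T1 : measurableType d1)
    (T2 : measurableType d2) (m1 : {sigma_finite_measure set T1 -> \bar R})
    (m2 : {sigma_finite_measure set T2 -> \bar R}) :
  sigma_finite [set: T1 * T2] (m1 \x m2)%E.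
Proof.
have [F TF Foo] := sigma_finiteT m1; have [G TG Goo] := sigma_finiteT m2.
pose H (ij : nat * nat) := F ij.1 `*` G ij.2.
exists (fun n => if unpickle n is Some ij then H ij else set0).
  apply/esym; rewrite -subTset => -[x y] _.
  have [i _ Fix] : (\bigcup_i F i) x by rewrite -TF.
  have [j _ Gjy] : (\bigcup_i G i) y by rewrite -TG.
  by exists (pickle (i, j)) => //; rewrite pickleK.
move=> n; case: unpickle => [[i j]|]; last by rewrite measure0.
have [mF Fi] := Foo i; have [mG Gj] := Goo j.
split; first exact: measurableX.
by rewrite /H/= product_measure1E// lte_mul_pinfty// ge0_fin_numE.
Qed.

(** Packaged as a sigma-finite measure, the product can be a factor again when the next axis is
    added. *)
Definition sigma_finite_product (R : realType) d1 d2 (T1 : measurableType d1)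
    (T2 : measurableType d2) (m1 : {sigma_finite_measure set T1 -> \bar R})
    (m2 : {sigma_finite_measure set T2 -> \bar R}) :
  {sigma_finite_measure set (T1 * T2)%type -> \bar R} :=
  HB.pack (m1 \x m2)%E (Measure_isSigmaFinite.Build _ _ _ (m1 \x m2)%E
    (sigma_finite_product_measure _ _ _ _ _ m1 m2)).

(* A parametrization of the span of the axes of [S] by a measure space in which
   Fubini's theorem applies, together with Rademacher's theorem along [S]. *)
Definition rademacher_along (R : realType) (m n : nat) (S : seq ('I_m * 'I_n)) : Prop :=
  exists d (T : measurableType d) (mu : {sigma_finite_measure set T -> \bar R})
      (phi : T -> 'M[R]_(m, n)),
    [/\ borel_param R d T _ phi,
        forall r : R, 0 < r -> (0 < mu [set t | (`|phi t| < r)%R])%E &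
        forall (f : 'M[R]_(m, n) -> R) (L : R) (x : 'M[R]_(m, n)),
          (forall y z, `|f y - f z| <= L * `|y - z|) ->
          mu [set t | ~ differentiable_along R m n f (mx_support R m n S) (x + phi
            t)] = 0%E].

(** Without axes the only direction is zero. A constant map on any space of positive measure will
    do; the real line is one. *)
Lemma rademacher_along_nil (R : realType) (m n : nat) : rademacher_along R m n [::].
Proof.
exists _, (measurableTypeR R), lebesgue_measure, (cst 0); split.
- by move=> F _; apply: (measurable_cst (F 0)).
- move=> r r0; rewrite (_ : [set _ | _] = setT).
    rewrite (@lt_le_trans _ _ (lebesgue_measure (`[0, 1]%classic :
      set (measurableTypeR R))))//.
      by rewrite lebesgue_measure_itv/= lte_fin ltr01 oppr0 adde0 lte_fin.
    by apply: le_measure; rewrite ?inE//; exact: measurable_itv.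
  by apply/seteqP; split => // t _ /=; rewrite normr0.
- move=> f L x _; rewrite (_ : [set _ | _] = set0) ?measure0//.
  apply/seteqP; split => // t; apply => e e0; exists 0, 1 => // h h0 _.
  have -> : h = 0 by apply/matrixP => i j; rewrite h0// mxE.
  by rewrite !addr0 subrr sub0r -(scale0r (0 :
    'M[R]_(m, n))) frobZr mul0r oppr0 !scale0r !normr0 mulr0.
Qed.

Lemma measurable_not_differentiable_along (R : realType) d (T : measurableType d)
    (m n : nat) (phi : T -> 'M[R]_(m, n)) f W x :
  borel_param R d T _ phi -> continuous f ->
  measurable [set t | ~ differentiable_along R m n f W (x + phi t)].
Proof.
move=> mphi cf; apply: measurableC.
by have := measurable_differentiable_along R d T m n _ f W (borel_param_shift R d T _
  _ x mphi) cf.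
Qed.

(** A real parameter for the new axis is added to the parameter space. Three exceptional sets are
    null by Fubini's theorem: for [f] along [S], for [f] along the new axis, and for the distances
    to countably many sets [E] along that axis. Off these, [differentiable_along_cons] applies. *)
Lemma rademacher_along_cons (R : realType) (m n : nat) (i : 'I_m) (j : 'I_n)
    (S : seq ('I_m * 'I_n)) :
  rademacher_along R m n S -> rademacher_along R m n ((i, j) :: S).
Proof.
move=> [d [T [mu [phi [mphi phi0 phiS]]]]].
pose D := delta_mx i j : 'M[R]_(m, n).
pose psi (z : (T * measurableTypeR R)%type) : 'M[R]_(m, n) := phi z.1 + z.2 *: D.
pose lam : {sigma_finite_measure set (measurableTypeR R) -> \bar R} := lebesgue_measure.
pose nu := sigma_finite_product R _ _ _ _ mu lam.
have mpsi : borel_param R _ _ _ psi by exact: borel_paramD.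
have cont (f : 'M[R]_(m, n) -> R) (L : R) (fL :
  forall y z, `|f y - f z| <= L * `|y - z|) : continuous f.
  exact: continuous_of_lipschitz fL.
have nax (f : 'M[R]_(m, n) -> R) (L : R) (x : 'M[R]_(m, n)) (fL :
  forall y z, `|f y - f z| <= L * `|y - z|) :
    nu.-negligible [set z | ~ differentiable_along R m n f (mx_axis R m n i j) (x +
      psi z)].
  apply/negligibleP; first exact: measurable_not_differentiable_along (cont _ _ fL).
  apply: product_measure_null_xsection => t.
  apply: measure_negligible.
    apply: measurable_xsection.
    exact: measurable_not_differentiable_along (cont _ _ fL).
  have := lipschitz_axis_negligible R m n f L i j (x + phi t) fL.
  apply: negligibleS => s; rewrite /xsection/= inE /=.
  by rewrite /psi/= addrA.
exists _, (T * measurableTypeR R)%type, nu, psi; split => //.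
- move=> r r0.
  have r20 : 0 < r / 2 by rewrite divr_gt0.
  apply: (@lt_le_trans _ _ (nu ([set t | (`|phi t| < r / 2)%R] `*`
      (`]- (r / 2), r / 2[%classic : set (measurableTypeR R))))).
    rewrite /nu/= product_measure1E//; first last.
    + exact: borel_param_ball.
    apply: mule_gt0; first exact: phi0.
    have := @lebesgue_measure_itv R `]- (r / 2), r / 2[%R;
      rewrite /= lte_fin gtrN// => ->.
    by rewrite -EFinB lte_fin opprK addr_gt0.
  apply: le_measure; rewrite ?inE.
  + by apply: measurableX; [exact: borel_param_ball|exact: measurable_itv].
  + exact: borel_param_ball.
  move=> [t s] [/= pt]; rewrite in_itv/= -ltr_norml => sr.
  rewrite (le_lt_trans (ler_normD _ _))// [r]splitr ltrD//.
  exact: le_lt_trans (mx_axis_norm_le _ _ _ _ _ _) sr.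
- move=> f L x fL.
  apply: measure_negligible; first exact: measurable_not_differentiable_along (cont _
    _ fL).
  have n1 : nu.-negligible
      [set z | ~ differentiable_along R m n f (mx_support R m n S) (x + psi z)].
    have mB := measurable_not_differentiable_along R _ _ m n psi f (mx_support R m n
      S) x mpsi (cont _ _ fL).
    apply/negligibleP => //.
    (* For fixed [s] this is the induction hypothesis at the base point [x + s *: D]. *)
    apply: product_measure_null_ysection => // s.
    rewrite -[RHS](phiS f L (x + s *: D) fL); congr (mu _).
    apply/seteqP; split => t; rewrite /ysection/= inE/= /psi/= => H;
      by rewrite -?addrA (addrC (s *: D)) in H *.
  pose E (k l : nat) (C : 'M[rat]_(m, n)) :=
    lin_approx R m n f (mx_support R m n S) (rat_mx R m n C) l.+1%:R^-1 k.+1%:R^-1.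
  (* Only nonempty [E] are considered, since the distance is known to be Lipschitz for these; an [E]
     containing the point at hand is one of them. *)
  have n3 : nu.-negligible (\bigcup_(u : (nat * nat * 'M[rat]_(m, n))%type)
      [set z | E u.1.1 u.1.2 u.2 !=set0 /\ ~ differentiable_along R m n
        (set_dist R _ (E u.1.1 u.1.2 u.2)) (mx_axis R m n i j) (x + psi z)]).
    apply: negligible_bigcup_countable => -[[k l] C] /=.
    have [E0|E0] := pselect (E k l C !=set0); last first.
      by apply: negligibleS (negligible_set0 _) => z [].
    apply: negligibleS (nax (set_dist R _ (E k l C)) 1 x _) => [z []//|y z].
    exact: set_dist_lipschitz.
  apply: negligibleS (negligibleU (negligibleU n1 (nax f L x fL)) n3).
  move=> z /= Hz; apply: contrapT => /not_orP[/not_orP[/contrapT H1 /contrapT H2] H3].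
  apply: Hz; apply: (differentiable_along_cons R m n f L i j S _ fL H1 H2) =>
    k l C /= Ez.
  apply: contrapT => H; apply: H3; exists (k, l, C) => //=; split => //.
  by eexists; exact: Ez.
Qed.

Lemma rademacher_setT (R : realType) (m n : nat) :
  rademacher_along R m n (enum {: 'I_m * 'I_n}).
Proof.
elim: (enum _) => [|[i j] S]; first exact: rademacher_along_nil.
exact: rademacher_along_cons.
Qed.

Lemma mx_support_enum (R : realType) (m n : nat) :
  mx_support R m n (enum {: 'I_m * 'I_n}) = setT.
Proof. by apply/seteqP; split => // h _ i j; rewrite mem_enum. Qed.

Lemma frob_continuous (R : realType) (m n : nat) (A : 'M[R]_(m, n)) :
  continuous (frob A).
Proof.
apply: (continuous_of_lipschitz R _ _ _ ((m * n)%:R * `|A|)) => B C.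
rewrite -[- frob A C]mulN1r -frobZr -frobDr scaleN1r.
by apply: frob_le => i j; exact: le_entry_mx_norm.
Qed.

(** The codomain [R^o] is a normed module, so that this form can serve as a differential. *)
Definition frob_form (R : realType) (m n : nat) (A : 'M[R]_(m, n)) (B :
  'M[R]_(m, n)) : R^o :=
  frob A B.

Lemma frob_form_linear (R : realType) (m n : nat) (A : 'M[R]_(m, n)) :
  linear (frob_form R m n A).
Proof. by move=> a B C; rewrite /frob_form frobDr frobZr. Qed.

HB.instance Definition _ (R : realType) (m n : nat) (A : 'M[R]_(m, n)) :=
  GRing.isLinear.Build R 'M[R]_(m, n) R^o _ (frob_form R m n A)
    (frob_form_linear R m n A).

(** Testing both approximations on the same small multiple of [delta_mx i j] compares the entries of
    the two forms. *)
Lemma lin_approx_setT_entry (R : realType) (m n : nat) (f : 'M[R]_(m, n) -> R)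
    (C D : 'M[R]_(m, n)) (r s e g : R) (x : 'M[R]_(m, n)) :
  0 < r -> 0 < s -> lin_approx R m n f setT C r e x -> lin_approx R m n f setT D s g
    x ->
  0 <= e + g -> `|C - D| <= e + g.
Proof.
move=> r0 s0 Cx Dx eg; apply: mx_norm_le => // i j; rewrite !mxE.
pose u := Num.min r s / 2.
have rs0 : 0 < Num.min r s by rewrite lt_min r0.
have u0 : 0 < u by rewrite divr_gt0.
have urs : u < Num.min r s by rewrite ltr_pdivrMr// ltr_pMr// ltr1n.
have uD : `|u *: (delta_mx i j : 'M[R]_(m, n))| = u.
  apply/eqP; rewrite eq_le -{2 3}(gtr0_norm u0).
  by rewrite mx_axis_norm_le mx_axis_norm_ge.
have /andP[ur us] : (u < r) && (u < s) by rewrite -lt_min.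
have := Cx (u *: delta_mx i j) I; have := Dx (u *: delta_mx i j) I.
rewrite uD !frobZr !frob_deltar => /(_ us) A1 /(_ ur) A2.
rewrite -(ler_pM2l u0) -{1}(gtr0_norm u0) -normrM.
by move: A1 A2; rewrite !ler_norml => /andP[? ?] /andP[? ?]; apply/andP; split; lra.
Qed.

(** Forms approximating [f] up to [a k] and [a l] differ by at most [a k + a l]. They therefore form
    a Cauchy sequence, whose limit represents the differential. *)
Lemma differentiable_along_setT (R : realType) (m n : nat) (f : 'M[R]_(m, n) -> R)
    (x : 'M[R]_(m, n)) :
  differentiable_along R m n f setT x -> differentiable f x.
Proof.
move=> fx.
pose a (k : nat) : R := k.+1%:R^-1.
have a0 k : 0 < a k by rewrite invr_gt0 ltr0Sn.
have /choice[C CP] (k : nat) : exists C : 'M[R]_(m, n),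
    exists2 r, 0 < r & lin_approx R m n f setT C r (a k) x by exact: fx.
have CC k l : `|C k - C l| <= a k + a l.
  have [r r0 rP] := CP k; have [s s0 sP] := CP l.
  by apply: lin_approx_setT_entry rP sP _ => //; rewrite addr_ge0// ltW.
have /cvg_ex[D CD] : cvg (C @ \oo).
  apply: cauchy_cvg; apply: cauchy_exP => e e0.
  have e20 : 0 < e / 2 by rewrite divr_gt0.
  have [N _ NP] := near_infty_natSinv_lt (PosNum e20).
  exists (C N); exists N => // k /= Nk.
  rewrite -ball_normE /=; apply: le_lt_trans (CC _ _) _.
  by rewrite [e]splitr; apply: ltrD; [apply: (NP N) => /= | exact: (NP k)].
have [|e e0|//] := @expansion_differentiable R _ R^o f (frob_form R m n D) x.
  exact: frob_continuous.
pose K : R := (m * n).+1%:R.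
have K0 : 0 < K by rewrite ltr0Sn.
pose e' := e / (2 * K).
have e'0 : 0 < e' by rewrite divr_gt0// mulr_gt0.
have [k [ak CkD]] : exists k, a k < e' /\ `|C k - D| <= e'.
  near \oo => k; exists k; split.
    by near: k; exact: (near_infty_natSinv_lt (PosNum e'0)).
  by rewrite distrC ltW//; near: k; exact: (@cvgr_dist_lt _ _ _ _ _ C D CD).
have [r r0 rP] := CP k; exists r => // h hr.
have := lin_approx_form R m n f setT (C k) D r (a k) e' _ x rP h I hr.
move=> /(_ _)/le_trans; apply.
  by move=> i j; have := le_entry_mx_norm R m n (C k - D) i j;
    rewrite !mxE => /le_trans; apply.
rewrite ler_wpM2r//.
have KE : K = (m * n)%:R + 1 by rewrite /K -natr1.
have -> : e = e' * K + e' * K by rewrite /e'; field; rewrite gt_eqF.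
rewrite lerD//; first by rewrite (le_trans (ltW ak))// ler_peMr ?(ltW e'0)// KE lerDr.
by rewrite mulrC ler_wpM2l ?(ltW e'0)// KE lerDl.
Unshelve. all: by end_near. Qed.

(** * Clarke's directional derivative *)

Lemma has_slope_differential (R : realType) (V : normedModType R) (f : V -> R)
    (x v : V) (c : R) : differentiable f x ->
  (forall e, 0 < e -> exists2 r, 0 < r &
    forall h, `|h| < r -> `|f (x + h *: v) - f x - c * h| <= e * `|h|) ->
  'd f x v = c.
Proof.
move=> dfx fc; apply/eqP; rewrite -subr_eq0 -normr_le0.
apply/ler_addgt0Pr => e e0; rewrite add0r.
pose K := `|v| + 1.
have K0 : 0 < K by rewrite ltr_wpDl.
have e1 : 0 < e / 2 by rewrite divr_gt0.
have e2 : 0 < e / 2 / K by rewrite divr_gt0.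
have [r r0 rP] := fc _ e1; have [s s0 sP] :=
  differentiable_expansion R _ _ f x dfx _ e2.
pose q := Num.min r (s / K).
have q0 : 0 < q by rewrite lt_min r0 divr_gt0.
pose h := q / 2.
have h0 : 0 < h by rewrite divr_gt0.
have hq : h < q by rewrite ltr_pdivrMr// ltr_pMr// ltr1n.
have hr : `|h| < r by rewrite gtr0_norm// (lt_le_trans hq)// ge_min lexx.
have hv : `|h *: v| <= h * K.
  by rewrite normrZ gtr0_norm// ler_wpM2l ?(ltW h0)// lerDl.
have hs : `|h *: v| < s.
  rewrite (le_lt_trans hv)// -ltr_pdivlMr// (lt_le_trans hq)// ge_min lexx orbT//.
have H1 := rP h hr; have := sP _ hs; rewrite linearZ => H2.
have {}H2 := le_trans H2 (ler_wpM2l (ltW e2) hv).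
have E : e / 2 / K * (h * K) = e / 2 * h by field; rewrite gt_eqF.
rewrite E in H2; rewrite (gtr0_norm h0) in H1.
rewrite -(ler_pM2l h0) -{1}(gtr0_norm h0) -normrM.
have -> : h * ('d f x v - c) =
    (f (x + h *: v) - f x - c * h) - (f (x + h *: v) - f x - h * 'd f x v) by ring.
have -> : h * e = e / 2 * h + e / 2 * h by field.
exact: le_trans (ler_normB _ _) (lerD H1 H2).
Qed.

(** The segment itself may miss the points of differentiability. By Fubini's theorem almost every
    parallel translate by [phi t] meets the exceptional set in a null set, and a short translation
    preserves the gap; the mean value argument on the line then applies. *)
Lemma mx_lipschitz_mean_value (R : realType) (m n : nat) (f : 'M[R]_(m, n) -> R)
    (L : R) (x v : 'M[R]_(m, n)) (tau al r : R) :
  (forall y z, `|f y - f z| <= L * `|y - z|) -> 0 < tau -> 0 < r ->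
  al * tau < f (x + tau *: v) - f x ->
  exists z, exists s, [/\ 0 <= s <= tau, `|z - (x + s *: v)| < r,
    differentiable f z & al < 'd f z v].
Proof.
move=> fL tau0 r0 gap.
have cf : continuous f by exact: continuous_of_lipschitz fL.
have [d [T [mu [phi [mphi phi0 phiS]]]]] := rademacher_setT R m n.
pose lam : {sigma_finite_measure set (measurableTypeR R) -> \bar R} := lebesgue_measure.
pose psi (z : (T * measurableTypeR R)%type) : 'M[R]_(m, n) := phi z.1 + z.2 *: v.
have mpsi : borel_param R _ _ _ psi by exact: borel_paramD.
pose B := [set z | ~ differentiable_along R m n f setT (x + psi z)].
have mB : measurable B.
  exact: (measurable_not_differentiable_along R _ _ m n psi f setT x mpsi cf).
have B0 : (mu \x lam)%E B = 0%E.
  apply: product_measure_null_ysection => // s.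
  rewrite -[RHS](phiS f L (x + s *: v) fL); congr (mu _); rewrite mx_support_enum.
  apply/seteqP; split => t; rewrite /ysection/= inE/= /B/= /psi/= => H;
    by rewrite -?addrA (addrC (s *: v)) in H *.
pose K := `|L| + 1.
have K0 : 0 < K by rewrite ltr_wpDl.
have fK y z : `|f y - f z| <= K * `|y - z|.
  rewrite (le_trans (fL _ _))// ler_wpM2r// (le_trans (ler_norm _))//.
  by rewrite lerDl.
(* Moving both endpoints by less than [q] changes the increment by less than [2 * K * q], which is
   at most the gap. *)
pose q := Num.min r ((f (x + tau *: v) - f x - al * tau) / (2 * K)).
have q0 : 0 < q by rewrite lt_min r0 divr_gt0 ?subr_gt0// mulr_gt0.
(* Parameters with [|phi t| < q] have positive measure, while those with a non-null section form a
   null set. *)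
have [t [tq Bt]] : exists t, `|phi t| < q /\ lam (xsection B t) = 0%E.
  apply: contrapT => H.
  have := phi0 q q0; apply/negP; rewrite -leNgt measure_le0; apply/eqP.
  apply: measure_negligible; first exact: borel_param_ball.
  have /(ae_eq_integral_abs mu measurableT (measurable_fun_xsection lam mB)) :
      (\int[mu]_t `|(lam \o xsection B) t| = 0)%E.
    by rewrite -[RHS]B0; apply: eq_integral => t _; rewrite gee0_abs.
  apply: negligibleS => t /= tq Bt; apply: H; exists t; split => //; exact: Bt.
have [rq qK] : q <= r /\ 2 * (K * q) <= f (x + tau *: v) - f x - al * tau.
  split; first by rewrite ge_min lexx.
  rewrite mulrA mulrC -ler_pdivlMr; last by rewrite mulr_gt0.
  by rewrite ge_min lexx orbT.
pose g s := f (x + phi t + s *: v).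
have gL s u : `|g s - g u| <= (K * `|v|) * `|s - u|.
  rewrite (le_trans (fK _ _))// opprD addrACA subrr add0r -scalerBl normrZ.
  by rewrite mulrAC mulrA.
have ggap : al * (tau - 0) < g tau - g 0.
  have A1 : `|f (x + phi t + tau *: v) - f (x + tau *: v)| <= K * `|phi t|.
    by rewrite (le_trans (fK _ _))// opprD addrACA subrr addr0 addrAC subrr add0r.
  have A2 : `|f (x + phi t) - f x| <= K * `|phi t|.
    by rewrite (le_trans (fK _ _))// addrAC subrr add0r.
  have A3 : K * `|phi t| < K * q by rewrite ltr_pM2l.
  rewrite /g scale0r addr0 subr0.
  by move: A1 A2; rewrite !ler_norml => /andP[? ?] /andP[? ?]; lra.
have N0 : lam.-negligible (xsection B t).
  by apply/negligibleP => //; exact: measurable_xsection.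
have [s [c [/andP[s0 st] Ns gc alc]]] :=
  lipschitz_mean_value R g _ 0 tau al _ gL tau0 ggap N0.
have dz : differentiable f (x + phi t + s *: v).
  apply: differentiable_along_setT; apply: contrapT => H; apply: Ns.
  by rewrite /xsection /= inE /B /= /psi /= addrA.
exists (x + phi t + s *: v), s; split => //.
- by rewrite (ltW s0) (ltW st).
- by rewrite opprD addrACA subrr addr0 addrAC subrr add0r (lt_le_trans tq).
- by rewrite (has_slope_differential R _ f _ v c dz)// => e e0;
  have [u u0 uP] := gc e e0; exists u => // h /uP; rewrite /g scalerDl addrA.
Qed.

(* Truncating every entry to within [r] of that of [Z] is 1-Lipschitz for the
   maximum norm. *)
Lemma locally_lipschitz_extension (R : realType) (m n : nat) (f : 'M[R]_(m, n) -> R)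
    (Z : 'M[R]_(m, n)) : locally_lipschitz f ->
  exists r L (g : 'M[R]_(m, n) -> R), [/\ 0 < r,
    forall x y, `|g x - g y| <= L * `|x - y| &
    forall x, `|x - Z| < r -> g x = f x].
Proof.
move=> /(_ Z)[U /nbhs_ballP[e /= e0 eU] [M [_ /(_ (`|M| + 1)) HM]]].
(* Truncated matrices may be at distance exactly [r] from [Z]; halving keeps them in the open ball
   inside [U]. *)
pose r := e / 2.
have r0 : 0 < r by rewrite divr_gt0.
pose t (i : 'I_m) (j : 'I_n) (a : R) := Num.min (Num.max a (Z i j - r)) (Z i j + r).
have t1 i j a b : `|t i j a - t i j b| <= `|a - b|.
  wlog ab : a b / a <= b.
    by move=> H; have [/H//|/ltW/H] := leP a b; rewrite distrC (distrC b).
  rewrite (distrC a) (ger0_norm (_ : 0 <= b - a)) ?subr_ge0//.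
  by rewrite /t /Num.min /Num.max; do !case: ifPn; rewrite -?leNgt ler_norml => *;
    apply/andP; split; lra.
have tZ i j a : `|t i j a - Z i j| <= r.
  by rewrite /t /Num.min /Num.max; do !case: ifPn; rewrite -?leNgt ler_norml => *;
    apply/andP; split; lra.
have tid i j a : `|a - Z i j| < r -> t i j a = a.
  rewrite ltr_norml => /andP[? ?].
  by rewrite /t /Num.min /Num.max; do !case: ifPn; rewrite -?leNgt => *; lra.
pose T (x : 'M[R]_(m, n)) : 'M[R]_(m, n) := \matrix_(i, j) t i j (x i j).
have TU x : U (T x).
  apply: eU; rewrite -ball_normE /= distrC (@le_lt_trans _ _ r)//.
    by apply: mx_norm_le (ltW r0) _ => i j; rewrite !mxE; exact: tZ.
  by rewrite ltr_pdivrMr// ltr_pMr// ltr1n.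
exists r, (`|M| + 1), (f \o T); split => // [x y|x xZ] /=.
  have := HM (_ : M < `|M| + 1); rewrite (le_lt_trans (ler_norm _)) ?ltrDl//.
  move=> /(_ isT)/(_ (T x, T y) (conj (TU x) (TU y)))/= /le_trans; apply.
  rewrite ler_wpM2l ?addr_ge0//; apply: mx_norm_le => // i j; rewrite !mxE.
  by rewrite (le_trans (t1 _ _ _ _))//; have := le_entry_mx_norm R m n (x - y) i j;
    rewrite !mxE.
congr f; apply/matrixP => i j; rewrite mxE tid//.
by have := le_entry_mx_norm R m n (x - Z) i j; rewrite !mxE => /le_lt_trans; apply.
Qed.

Lemma differentiable_near_eq (R : realType) (V : normedModType R) (f g : V -> R)
    (Z z : V) (r : R) : (forall x, `|x - Z| < r -> g x = f x) -> `|z - Z| < r ->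
  differentiable g z -> differentiable f z /\ 'd f z = 'd g z :> (V -> R).
Proof.
move=> gf zZ dg.
apply: (@expansion_differentiable R V R^o f ('d g z) z);
  first by move/diff_locallyP : (dg) => [].
move=> e e0; have [s s0 sP] := differentiable_expansion R V R^o g z dg e e0.
exists (Num.min s (r - `|z - Z|)); first by rewrite lt_min s0 subr_gt0.
move=> h; rewrite lt_min => /andP[hs hr].
rewrite -!gf//; first exact: sP.
rewrite addrAC (le_lt_trans (ler_normD _ _))//. by rewrite -ltrBrDl.
Qed.

Lemma lipschitz_differential_le (R : realType) (V : normedModType R) (f : V -> R)
    (Z z h : V) (r L : R) : (forall x y,
      `|x - Z| < r -> `|y - Z| < r -> `|f x - f y| <= L * `|x - y|) ->
  `|z - Z| < r -> differentiable f z -> `|'d f z h| <= L * `|h|.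
Proof.
move=> fL zZ df.
have [->|h0] := eqVneq h 0; first by rewrite linear0 !normr0 mulr0.
have nh : 0 < `|h| by rewrite normr_gt0.
apply/ler_addgt0Pr => e e0.
have e1 : 0 < e / `|h| by rewrite divr_gt0.
have [s s0 sP] := differentiable_expansion R V R^o f z df _ e1.
pose q := Num.min s (r - `|z - Z|).
have q0 : 0 < q by rewrite lt_min s0 subr_gt0.
pose u := q / 2 / `|h|.
have u0 : 0 < u by rewrite !divr_gt0.
have uh : `|u *: h| = q / 2 by rewrite normrZ gtr0_norm// /u divfK// gt_eqF.
have uq : `|u *: h| < q by rewrite uh ltr_pdivrMr// ltr_pMr// ltr1n.
have us : `|u *: h| < s by rewrite (lt_le_trans uq)// ge_min lexx.
have ur : `|z + u *: h - Z| < r.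
  rewrite addrAC (le_lt_trans (ler_normD _ _))// -ltrBrDl (lt_le_trans uq)//.
  by rewrite ge_min lexx orbT.
have := sP _ us; have := fL _ _ ur zZ.
rewrite (addrC z) addrK addrC linearZ normrZ (gtr0_norm u0) => H1 H2.
rewrite -(ler_pM2l u0) -{1}(gtr0_norm u0) -normrM.
have -> : u * 'd f z h = (f (z + u *: h) - f z) - (f (z + u *: h) - f z - u * 'd f z
  h) by ring.
apply: le_trans (ler_normB _ _) _.
have -> : u * (L * `|h| + e) = L * (u * `|h|) + e / `|h| * (u * `|h|).
  by field; rewrite gt_eqF.
exact: lerD.
Qed.

(** * Limiting gradients: closedness, compactness and directional bounds *)

(** This form without sequences is the one used below; a sequence is recovered by choice at the
    radii [1 / (k + 1)]. *)
Lemma limiting_gradientsP (R : realType) (V : normedModType R) (ip : V -> V -> R)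
    (f : V -> R) (x s : V) :
  limiting_gradients ip f x s <-> forall e, 0 < e ->
    exists z, [/\ `|z - x| < e, differentiable f z & `|gradient ip f z - s| < e].
Proof.
split => [[y [yx dy ys]] e e0|H].
  near \oo => k; exists (y k); split => //.
    by rewrite distrC; near: k; exact: (@cvgr_dist_lt _ _ _ _ _ y x yx).
  by rewrite distrC; near: k; exact: (@cvgr_dist_lt _ _ _ _ _ _ s ys).
have /choice[y yP] (k : nat) : exists z, [/\ `|z - x| < k.+1%:R^-1, differentiable f z &
    `|gradient ip f z - s| < k.+1%:R^-1] by apply: H; rewrite invr_gt0 ltr0Sn.
exists y; split; [|by move=> k; case: (yP k)|].
  apply/cvgrPdist_lt => e e0; have := near_infty_natSinv_lt (PosNum e0).
  by apply: filterS => k; rewrite distrC; case: (yP k) => + _ _ => /lt_trans; apply.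
apply/cvgrPdist_lt => e e0; have := near_infty_natSinv_lt (PosNum e0).
by apply: filterS => k; rewrite distrC; case: (yP k) => _ _ => /lt_trans; apply.
Unshelve. all: by end_near. Qed.

Lemma closed_limiting_gradients (R : realType) (V : normedModType R) (ip : V -> V -> R)
    (f : V -> R) (x : V) : closed (limiting_gradients ip f x).
Proof.
move=> s cs; apply/limiting_gradientsP => e e0.
have e20 : 0 < e / 2 by rewrite divr_gt0.
have [t [/limiting_gradientsP/(_ _ e20)[z [zx dz zt]] ts]] :=
  cs _ (nbhsx_ballx s _ e20).
exists z; split => //; first by rewrite (lt_le_trans zx)// ler_pdivrMr// ler_pMr//
  ler1n.
move: ts; rewrite -ball_normE /= distrC => ts.
by rewrite -(subrK t (gradient ip f z)) -addrA (le_lt_trans (ler_normD _ _))//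
  [e]splitr ltrD.
Qed.

(** Reduces to row vectors: [vec_mx] does not increase the maximum norm, so [A] is a continuous
    image of a bounded closed set of row vectors. *)
Lemma compact_mx_bounded_closed (R : realType) (m n : nat) (A :
  set 'M[R]_(m, n)) (L : R) :
  (forall B, A B -> `|B| <= L) -> closed A -> compact A.
Proof.
move=> AL cA.
have vec1 (u : 'rV[R]_(m * n)) : `|vec_mx u| <= 1 * `|u|.
  rewrite mul1r; apply: mx_norm_le => // i j; rewrite mxE.
  exact: le_entry_mx_norm.
have cvec : continuous (@vec_mx R m n).
  apply: (continuous_of_lipschitz R _ _ _ 1) => u v.
  by rewrite -linearB vec1.
have -> : A = @vec_mx R m n @` (@vec_mx R m n @^-1` A).
  apply/seteqP; split => [B AB|_ [u Au <-]//].
  by exists (mxvec B) => /=; rewrite mxvecK.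
apply: continuous_compact; first exact: continuous_subspaceT.
apply: bounded_closed_compact; last exact: (continuous_closedP _).1.
exists `|L|; split; first exact: num_real.
move=> M LM u /= /AL uL; apply: ltW; apply: le_lt_trans LM.
apply: mx_norm_le => // i k; rewrite (ord1 i).
have [a [b ->]] : exists a b, k = mxvec_index a b.
  by case/mxvec_indexP: k => a b; exists a, b.
have := le_entry_mx_norm R m n (vec_mx u) a b; rewrite mxE => /le_trans; apply.
by rewrite (le_trans uL)// ler_norm.
Qed.

Lemma frob_gradient (R : realType) (m n : nat) (f : 'M[R]_(m, n) -> R) (x h :
  'M[R]_(m, n)) :
  frob (gradient (@frob R m n) f x) h = 'd f x h.
Proof. exact: frob_riesz. Qed.

(** An entry of the gradient is the differential at some [delta_mx i j], which the local Lipschitz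
    constant bounds. *)
Lemma gradient_bound (R : realType) (m n : nat) (f : 'M[R]_(m, n) -> R)
    (Z : 'M[R]_(m, n)) : locally_lipschitz f ->
  exists2 r, 0 < r & exists L, forall z, `|z - Z| < r -> differentiable f z ->
    `|gradient (@frob R m n) f z| <= L.
Proof.
move=> fl; have [r [L [g [r0 gL gf]]]] := locally_lipschitz_extension R m n f Z fl.
exists r => //; exists `|L| => z zr dz.
apply: mx_norm_le => // i j; rewrite -frob_deltar frob_gradient.
have fL x y : `|x - Z| < r -> `|y - Z| < r -> `|f x - f y| <= `|L| * `|x - y|.
  by move=> /gf <- /gf <-; rewrite (le_trans (gL _ _))// ler_wpM2r// ler_norm.
apply: le_trans (lipschitz_differential_le R _ f Z z _ r `|L| fL zr dz) _.
by rewrite ler_piMr// mx_norm_delta_le.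
Qed.

Lemma compact_limiting_gradients (R : realType) (m n : nat) (f : 'M[R]_(m, n) -> R)
    (Z : 'M[R]_(m, n)) : locally_lipschitz f ->
  compact (limiting_gradients (@frob R m n) f Z).
Proof.
move=> fl; have [r r0 [L gL]] := gradient_bound R m n f Z fl.
apply: (compact_mx_bounded_closed R m n _ L); last exact: closed_limiting_gradients.
move=> s /limiting_gradientsP sG; apply/ler_addgt0Pr => e e0.
have [|z [zx dz zs]] := sG (Num.min e r); first by rewrite lt_min e0.
have zr : `|z - Z| < r by rewrite (lt_le_trans zx)// ge_min lexx orbT.
rewrite -(subrK (gradient (@frob R m n) f z) s) addrC.
rewrite (le_trans (ler_normD _ _))// lerD ?gL// distrC ltW// (lt_le_trans zs)//.
by rewrite ge_min lexx.
Qed.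

(* The hypothesis says that [c] is at most Clarke's generalized directional
   derivative of [f] at [Z] along [v]. *)
Lemma limiting_gradient_directional (R : realType) (m n : nat)
    (f : 'M[R]_(m, n) -> R) (Z v : 'M[R]_(m, n)) (c : R) : locally_lipschitz f ->
  (forall e, 0 < e -> exists x t, [/\ `|x - Z| < e, 0 < t < e &
     (c - e) * t < f (x + t *: v) - f x]) ->
  exists2 g, limiting_gradients (@frob R m n) f Z g & c <= frob g v.
Proof.
move=> fl H; have [r [L [g [r0 gL gf]]]] := locally_lipschitz_extension R m n f Z fl.
have diffH e : 0 < e -> exists z, [/\ `|z - Z| < e,
  differentiable f z & c - e < 'd f z v].
  move=> e0; pose q := Num.min e r.
  have q0 : 0 < q by rewrite lt_min e0.
  (* Thirds of [q] bound the distance from [x] to [Z], the length of the segment, and the deviation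
     of [z] from the segment. *)
  pose K := 3 * (`|v| + 1).
  have K0 : 0 < K by rewrite mulr_gt0// ltr_wpDl.
  have qK0 : 0 < q / K by rewrite divr_gt0.
  have q30 : 0 < q / 3 by rewrite divr_gt0.
  have [|x [t [xZ /andP[t0 tq] gap]]] := H (Num.min (q / K) (q / 3));
    first by rewrite lt_min qK0.
  move: xZ tq gap; set e' := Num.min _ _ => xZ tq gap.
  have e'q : e' <= q / 3 by rewrite ge_min lexx orbT.
  have e'K : e' <= q / K by rewrite ge_min lexx.
  have sv s : 0 <= s <= t -> `|x + s *: v - Z| < q / 3 + q / 3.
    move=> /andP[s0 st]; rewrite addrAC (le_lt_trans (ler_normD _ _))//.
    rewrite ltrD//; first exact: lt_le_trans xZ e'q.
    rewrite normrZ (ger0_norm s0) (@le_lt_trans _ _ (t * (`|v| + 1)))//.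
      by rewrite ler_pM// lerDl.
    rewrite (lt_le_trans (_ : _ < q / K * (`|v| + 1)))//.
      by rewrite ltr_pM2r ?ltr_wpDl// (lt_le_trans tq).
    by rewrite le_eqVlt; apply/orP; left; apply/eqP; rewrite /K; field;
      rewrite gt_eqF// ltr_wpDl.
  have q23 : q / 3 + q / 3 < q by lra.
  have qr : q <= r by rewrite ge_min lexx orbT.
  have qe : q <= e by rewrite ge_min lexx.
  have gap' : (c - e') * t < g (x + t *: v) - g x.
    rewrite !gf//.
      have := sv 0; rewrite lexx (ltW t0) scale0r addr0 => /(_ isT) /lt_trans; apply.
      exact: lt_le_trans q23 qr.
    have := sv t; rewrite lexx (ltW t0) => /(_ isT) /lt_trans; apply.
    exact: lt_le_trans q23 qr.
  have [z [s [st zs dz cz]]] := mx_lipschitz_mean_value R m n g L x v t _ _ gL t0 q30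
    gap'.
  have zZ : `|z - Z| < q.
    rewrite -(subrK (x + s *: v) z) -addrA (le_lt_trans (ler_normD _ _))//.
    by have := sv s st; lra.
  have [df dE] := differentiable_near_eq R _ f g Z z r gf (lt_le_trans zZ qr) dz.
  exists z; split => //; first exact: lt_le_trans qe.
  by rewrite dE (le_lt_trans _ cz)// lerD2l lerN2; lra.
have [r' r'0 [L' gL']] := gradient_bound R m n f Z fl.
have a0 (k : nat) : 0 < Num.min r' k.+1%:R^-1 by rewrite lt_min r'0 invr_gt0 ltr0Sn.
have /choice[z zP] k := diffH _ (a0 k).
pose G k := gradient (@frob R m n) f (z k).
have cK : compact [set A : 'M[R]_(m, n) | `|A| <= L'].
  apply: (compact_mx_bounded_closed R m n _ L') => //.
  have := (continuous_closedP _).1 (@norm_continuous _ 'M[R]_(m,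
    n)) _ (@closed_le _ L').
  by [].
(* The gradients at the points [z k] stay in a compact set. A cluster point replaces a subsequence:
   each of its neighbourhoods contains [G k] for arbitrarily large [k]. *)
have [|s [_ sG]] := cK (G @ \oo) _.
  exists 0 => // k _ /=; have [zZ dz _] := zP k; apply: gL' => //.
  by rewrite (lt_le_trans zZ)// ge_min lexx.
have near_s (e : R) (B : set 'M[R]_(m, n)) : 0 < e -> nbhs s B ->
    exists k, B (G k) /\ k.+1%:R^-1 < e.
  move=> e0 sB; have [N _ NP] := near_infty_natSinv_lt (PosNum e0).
  have GN : (G @ \oo) (G @` [set k | (N <= k)%N]) by exists N => // k Nk; exists k.
  have [_ [[k Nk <-] Bk]] := sG _ _ GN sB.
  by exists k; split => //; exact: NP.
exists s.
  apply/limiting_gradientsP => e e0.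
  have [k [Bk ke]] := near_s e _ e0 (nbhsx_ballx s _ e0).
  exists (z k); have [zZ dz _] := zP k; split => //.
    by rewrite (lt_trans (lt_le_trans zZ _) ke)// ge_min lexx orbT.
  by move: Bk; rewrite -ball_normE /= distrC.
apply/ler_addgt0Pr => e e0; have e20 : 0 < e / 2 by rewrite divr_gt0.
have sB : nbhs s [set A | frob A v < frob s v + e / 2].
  have cf : continuous (fun A : 'M[R]_(m, n) => frob A v).
    by rewrite (_ : (fun A => _) = frob v);
      [exact: frob_continuous|apply/funext => A; rewrite frobC].
  apply: (cf s [set y | y < frob s v + e / 2]); apply: open_nbhs_nbhs; split;
    first exact: open_lt.
  by rewrite /= ltrDl.
have [k [Bk ke]] := near_s _ _ e20 sB.
have [_ _ ck] := zP k; move: Bk => /=; rewrite frob_gradient => Bk.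
move: ck; rewrite ltrBlDr => /ltW/le_trans; apply.
rewrite [e]splitr addrA lerD ?(ltW Bk)// (le_trans _ (ltW ke))//.
by rewrite ge_min lexx orbT.
Qed.

(** * Convex hulls of compact sets *)

Lemma conv_hull_mix (R : realType) (V : lmodType R) (S : set V) (x y : V) (t : R) :
  0 <= t -> t <= 1 -> conv_hull S x -> conv_hull S y ->
  conv_hull S (t *: x + (1 - t) *: y).
Proof.
move=> t0 t1 Sx Sy C [Cc SC].
have := Cc x y (Itv01 t0 t1); rewrite !inE; apply.
  by apply: Sx.
by apply: Sy.
Qed.

Lemma conv_hull_min (R : realType) (V : lmodType R) (S C : set V) :
  (forall x y t, 0 <= t -> t <= 1 -> C x -> C y -> C (t *: x + (1 - t) *: y)) ->
  S `<=` C -> conv_hull S `<=` C.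
Proof.
move=> Cc SC; apply: smallest_sub => // x y t; rewrite !inE => Cx Cy.
by apply: Cc.
Qed.

(** The index [k] stands for [k + 1] points, so that there is always at least one. *)
Definition convex_combinations (R : realType) (V : lmodType R) (S : set V) (k : nat) :
    set V :=
  [set x | exists g : 'I_k.+1 -> V, exists w : 'I_k.+1 -> R,
    [/\ forall i, S (g i), forall i, 0 <= w i, \sum_i w i = 1 & x = \sum_i w i *: g i]].

(** Mixing in one point of [S] at a time keeps compactness an induction over products with [[0, 1]]
    and [S]. *)
Fixpoint iterated_join (R : realType) (V : lmodType R) (S : set V) (k : nat) : set V :=
  if k is k'.+1 then
    [set x | exists t y z, [/\ 0 <= t <= 1, iterated_join R V S k' y, S z &
      x = t *: y + (1 - t) *: z]]
  else S.

Lemma iterated_join_sub (R : realType) (V : lmodType R) (S : set V) (k : nat) :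
  S `<=` iterated_join R V S k.
Proof.
elim: k => // k IH x Sx; exists 0, x, x; split => //; first by rewrite lexx ler01.
  exact: IH.
by rewrite scale0r add0r subr0 scale1r.
Qed.

Lemma compact_iterated_join (R : realType) (V : normedModType R) (S : set V) (k : nat) :
  compact S -> compact (iterated_join R V S k).
Proof.
move=> cS; elim: k => // k IH.
rewrite (_ : iterated_join _ _ _ _ =
  (fun p : R * (V * V) => p.1 *: p.2.1 + (1 - p.1) *: p.2.2) @`
    (`[0, 1] `*` (iterated_join R V S k `*` S))).
  apply: continuous_compact.
    apply: continuous_subspaceT => p.
    have c1 : {for p, continuous (fun p : R * (V * V) => p.1)} by exact: cvg_fst.
    have c21 : {for p, continuous (fun p : R * (V * V) => p.2.1)}.
      by apply: continuous_comp; [exact: cvg_snd|exact: cvg_fst].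
    have c22 : {for p, continuous (fun p : R * (V * V) => p.2.2)}.
      by apply: continuous_comp; [exact: cvg_snd|exact: cvg_snd].
    apply: cvgD; first by apply: cvgZ.
    by apply: cvgZ => //; apply: cvgB => //; exact: cvg_cst.
  by apply: compact_setX; [exact: segment_compact|exact: compact_setX].
apply/seteqP; split => [x [t [y [z [t01 Jy Sz ->]]]]|_ [[t [y z]]] [/= t01 [Jy Sz]] <-].
  by exists (t, (y, z)).
by exists t, y, z; split => //; move: t01; rewrite in_itv.
Qed.

Lemma iterated_join_hull (R : realType) (V : lmodType R) (S : set V) (k : nat) :
  iterated_join R V S k `<=` conv_hull S.
Proof.
elim: k => [|k IH] x /=; first exact: sub_gen_smallest.
move=> [t [y [z [/andP[t0 t1] /IH Jy Sz ->]]]].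
by apply: conv_hull_mix => //; exact: sub_gen_smallest.
Qed.

Lemma convex_combinations_join (R : realType) (V : lmodType R) (S : set V) (k : nat) :
  convex_combinations R V S k `<=` iterated_join R V S k.
Proof.
elim: k => [|k IH] x [g [w [Sg w0 w1 ->]]].
  by move: w1; rewrite !big_ord1 => ->; rewrite scale1r.
rewrite big_ord_recr/=; set a := w ord_max.
have sE : \sum_(i < k.+1) w (widen_ord (leqnSn k.+1) i) = 1 - a.
  by apply/eqP; rewrite eq_sym subr_eq -w1 big_ord_recr.
have a1 : 0 <= 1 - a by rewrite -sE sumr_ge0.
(* The other weights are renormalized by [1 - a]. If this is zero they all vanish, and the last
   point alone remains. *)
have [a1'|a1'] := eqVneq (1 - a) 0.
  exists 0, (g ord_max), (g ord_max); split => //; first by rewrite lexx ler01.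
    exact: iterated_join_sub.
  rewrite scale0r add0r subr0 scale1r big1 ?add0r => [|i _].
    by move/eqP: a1'; rewrite subr_eq0 => /eqP <-; rewrite scale1r.
  have /eqP := sE; rewrite a1' psumr_eq0// => /allP/(_ i).
  by rewrite mem_index_enum => /(_ isT)/eqP ->; rewrite scale0r.
exists (1 - a), (\sum_(i < k.+1) (w (widen_ord (leqnSn k.+1) i) / (1 - a)) *:
  g (widen_ord (leqnSn k.+1) i)), (g ord_max); split => //.
- by rewrite a1 gerBl w0.
- apply: IH; eexists; eexists; split; last reflexivity => //.
  + by [].
  + by move=> i; rewrite divr_ge0.
  + by rewrite -mulr_suml sE divff.
- rewrite subKr scaler_sumr; congr (_ + _); apply: eq_bigr => i _.
  by rewrite scalerA mulrCA divff// mulr1.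
Qed.

Lemma convex_combinations_mix (R : realType) (V : lmodType R) (S : set V) (k l : nat)
    (x y : V) (t : R) : 0 <= t -> t <= 1 ->
  convex_combinations R V S k x -> convex_combinations R V S l y ->
  convex_combinations R V S (k + l.+1) (t *: x + (1 - t) *: y).
Proof.
move=> t0 t1 [g [w [Sg w0 w1 ->]]] [h [v [Sh v0 v1 ->]]].
pose G (i : 'I_(k.+1 + l.+1)) := match fintype.split i with inl a => g a | inr b =>
  h b end.
pose W (i : 'I_(k.+1 + l.+1)) :=
  match fintype.split i with inl a => t * w a | inr b => (1 - t) * v b end.
have spl (i : 'I_k.+1) : fintype.split (lshift l.+1 i) = inl i by exact: (unsplitK
  (inl i)).
have spr (i : 'I_l.+1) : fintype.split (rshift k.+1 i) = inr i by exact: (unsplitK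
  (inr i)).
exists G, W; split.
- by move=> i; rewrite /G; case: fintype.split.
- by move=> i; rewrite /W; case: fintype.split => j; rewrite mulr_ge0// subr_ge0.
- rewrite (@big_split_ord _ _ _ k.+1 l.+1)/=.
  under eq_bigr do rewrite /W spl.
  under [X in _ + X]eq_bigr do rewrite /W spr.
  by rewrite -!mulr_sumr w1 v1; ring.
- rewrite (@big_split_ord _ _ _ k.+1 l.+1)/= !scaler_sumr; congr (_ + _).
    by apply: eq_bigr => i _; rewrite /G /W spl scalerA.
  by apply: eq_bigr => i _; rewrite /G /W spr scalerA.
Qed.

(** A matrix with more rows than columns has a nonzero left kernel; the column of ones encodes that
    the coefficients sum to zero. *)
Lemma affine_dependence (R : realType) (m n k : nat) (g : 'I_k -> 'M[R]_(m, n)) :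
  ((m * n).+1 < k)%N ->
  exists u : 'I_k -> R, [/\ (exists i, u i != 0),
    \sum_i u i = 0 & \sum_i u i *: g i = 0].
Proof.
move=> mnk.
pose G : 'M[R]_(k, m * n) := \matrix_i mxvec (g i).
pose A : 'M[R]_(k, 1 + m * n) := row_mx (const_mx 1) G.
have : kermx A != 0.
  rewrite -mxrank_eq0 mxrank_ker subn_eq0 -ltnNge (leq_ltn_trans (rank_leq_col _))//.
move=> /rowV0Pn[u /sub_kermxP]; rewrite mul_mx_row => /eqP.
rewrite row_mx_eq0 => /andP[/eqP u1 /eqP uG] u0.
exists (u 0); split.
- have /rV0Pn[i ui] := u0; by exists i.
- have := congr1 (fun B : 'M[R]_(1, 1) => B 0 0) u1; rewrite mxE [RHS]mxE => E.
  by rewrite -[RHS]E; apply: eq_bigr => i _; rewrite mxE mulr1.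
- apply: (can_inj (@mxvecK _ m n)); rewrite linear0 linear_sum -[RHS]uG mulmx_sum_row.
  by apply: eq_bigr => i _; rewrite linearZ rowK.
Qed.

(** Subtracting a multiple of an affine dependence from the weights until one of them vanishes
    allows that point to be dropped. *)
Lemma caratheodory (R : realType) (m n k : nat) (S : set 'M[R]_(m, n)) :
  (m * n <= k)%N ->
  convex_combinations R _ S k.+1 `<=` convex_combinations R _ S k.
Proof.
move=> mnk x [g [w [Sg w0 w1 ->]]].
have [u [[i2 ui2] u1 ug]] := affine_dependence R m n k.+2 g (mnk :
  ((m * n).+1 < k.+2)%N).
have [i1 ui1] : exists i1, 0 < u i1.
  apply: contrapT => H.
  have uN i : 0 <= - u i by rewrite oppr_ge0 leNgt; apply/negP => ui; apply: H;
    exists i.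
  move: ui2; rewrite -oppr_eq0; have :=
    @psumr_eq0P R _ predT (fun i => - u i) (fun i _ => uN i).
  by rewrite sumrN u1 oppr0 => /(_ erefl i2 isT) ->; rewrite eqxx.
(* The least ratio over positive [u i] gives the largest multiple that keeps all weights
   nonnegative. *)
have [i0 ui0 imin] := @arg_minP _ _ _ i1 (fun i => 0 < u i) (fun i => w i / u i) ui1.
pose t := w i0 / u i0.
have t0 : 0 <= t by rewrite divr_ge0// ltW.
pose v i := w i - t * u i.
have v0 i : 0 <= v i.
  rewrite subr_ge0; have [ui|ui] := ltP 0 (u i).
    by rewrite -ler_pdivlMr// imin.
  by rewrite (le_trans _ (w0 i))// mulr_ge0_le0.
have vi0 : v i0 = 0 by rewrite /v /t divfK ?subrr// gt_eqF.
have v1 : \sum_i v i = 1 by rewrite sumrB -mulr_sumr u1 mulr0 subr0.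
have vg : \sum_i v i *: g i = \sum_i w i *: g i.
  under eq_bigr do rewrite scalerBl -scalerA.
  by rewrite sumrB -scaler_sumr ug scaler0 subr0.
exists (g \o lift i0), (v \o lift i0); split => //=.
- by rewrite -v1 (bigD1_ord i0)//= vi0 add0r.
- by rewrite -vg (bigD1_ord i0)//= vi0 scale0r add0r.
Qed.

(** The hull is the join of [m * n] steps: shorter combinations embed because joins increase with
    [k], longer ones are shortened by [caratheodory]. *)
Lemma compact_conv_hull (R : realType) (m n : nat) (S : set 'M[R]_(m, n)) :
  compact S -> compact (conv_hull S).
Proof.
move=> cS; rewrite (_ : conv_hull S = iterated_join R _ S (m * n)).
  exact: compact_iterated_join.
apply/seteqP; split; last exact: iterated_join_hull.
apply: (@subset_trans _ (\bigcup_k convex_combinations R _ S k)).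
  apply: conv_hull_min => [x y t t0 t1 [k _ Sx] [l _ Sy]|x Sx].
    by exists (k + l.+1)%N => //; exact: convex_combinations_mix.
  by exists 0%N => //; exists (fun=> x), (fun=> 1); split => //;
    rewrite !big_ord1 ?scale1r.
have joinS k : iterated_join R _ S k `<=` iterated_join R _ S k.+1.
  move=> x Jx; have [z Sz] : exists z, S z.
    by case: k Jx => [|k] /=; [exists x|move=> [_ [_ [z [_ _ Sz _]]]]; exists z].
  exists 1, x, z; split => //; first by rewrite ler01 lexx.
  by rewrite scale1r subrr scale0r addr0.
have up k l : iterated_join R _ S k `<=` iterated_join R _ S (k + l).
  elim: l => [|l IH]; first by rewrite addn0.
  by rewrite addnS; apply: subset_trans IH (joinS _).
move=> x [k _ xk]; have [mnk|mnk] := leqP (m * n) k; last first.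
  by rewrite -(subnKC (ltnW mnk)); apply: up; exact: convex_combinations_join.
apply: convex_combinations_join; move: xk; rewrite -(subnKC mnk).
elim: (k - m * n)%N => [|j IH]; first by rewrite addn0.
by rewrite addnS => /caratheodory - /(_ (leq_addr _ _)).
Qed.

(** * The factorization map *)

Lemma frob_sqr (R : realType) (m n : nat) (A : 'M[R]_(m, n)) :
  frob A A = \sum_i \sum_j A i j ^+ 2.
Proof. by rewrite frobE; do 2!apply: eq_bigr => ? _; rewrite expr2. Qed.

Lemma frob_ge0 (R : realType) (m n : nat) (A : 'M[R]_(m, n)) : 0 <= frob A A.
Proof. by rewrite frob_sqr; do 2!apply: sumr_ge0 => ? _; exact: sqr_ge0. Qed.

Lemma frob_eq0 (R : realType) (m n : nat) (A : 'M[R]_(m, n)) : frob A A = 0 -> A = 0.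
Proof.
move=> A0; apply/matrixP => i j; rewrite mxE; apply/eqP; rewrite -sqrf_eq0; apply/eqP.
have A2 k l : 0 <= A k l ^+ 2 by exact: sqr_ge0.
rewrite frob_sqr in A0.
have Ai := @psumr_eq0P R _ predT _ (fun k _ => sumr_ge0 _ (fun l _ => A2 k l)) A0 i isT.
exact: (@psumr_eq0P R _ predT _ (fun l _ => A2 i l) Ai j isT).
Qed.

Lemma mx_norm_mul (R : realType) (m n p : nat) (A : 'M[R]_(m, n)) (B : 'M[R]_(n, p)) :
  `|A *m B| <= n%:R * `|A| * `|B|.
Proof.
apply: mx_norm_le => [|i j]; first by rewrite !mulr_ge0.
rewrite mxE (le_trans (ler_norm_sum _ _ _))//
  -mulrA mulr_natl -[X in _ *+ X]card_ord -sumr_const.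
by apply: ler_sum => k _; rewrite normrM ler_pM// le_entry_mx_norm.
Qed.

Lemma mx_norm_tr (R : realType) (m n : nat) (A : 'M[R]_(m, n)) : `|A^T| = `|A|.
Proof.
have H (p q : nat) (B : 'M[R]_(p, q)) : `|B^T| <= `|B|.
  by apply: mx_norm_le => // i j; rewrite mxE le_entry_mx_norm.
by apply/eqP; rewrite eq_le H -{1}(trmxK A) H.
Qed.

(** If [v *m V *m V^T = 0], then [v *m V] has zero Frobenius norm, so [v = 0] by row freeness. *)
Lemma gram_unitmx (R : realType) (r d : nat) (V : 'M[R]_(r, d)) :
  row_free V -> V *m V^T \in unitmx.
Proof.
move=> Vf; rewrite -row_free_unit; apply: inj_row_free => v vV.
have : frob (v *m V)^T (v *m V)^T = 0.
  by rewrite /frob trmxK trmx_mul mulmxA -(mulmxA v) vV mul0mx mxtrace0.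
move/frob_eq0/(congr1 trmx); rewrite trmxK trmx0 => vV0.
by apply: (row_free_inj Vf); rewrite vV0 mul0mx.
Qed.

(** The left kernel of [C] has dimension at least [d - k], hence at least [r]; the first [r] rows of
    a basis are taken. *)
Lemma exists_orthogonal_rows (R : realType) (r k d : nat) (C : 'M[R]_(d, k)) :
  (k + r <= d)%N -> exists2 V : 'M[R]_(r, d), row_free V & V *m C = 0.
Proof.
move=> krd; pose B := row_base (kermx C).
have rB : (r <= \rank (kermx C))%N.
  by rewrite mxrank_ker leq_subRL ?rank_leq_row// (leq_trans _ krd)//
    leq_add2r rank_leq_col.
exists (pid_mx r *m B).
  by rewrite /row_free mxrankMfree ?row_base_free// rank_pid_mx.
rewrite -mulmxA (_ : B *m C = 0) ?mulmx0//.
by apply/sub_kermxP; rewrite eq_row_base.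
Qed.

(** With the rows of [V] orthogonal to the columns of [X] and [Y], adding [a *: V^T] to [X] and
    [a^-1 *: (V^T *m invmx Q *m E)] to [Y] makes both cross terms vanish and changes the product by
    exactly [E]. *)
Lemma H_MF_open_left (R : realType) (d m n : nat) (X : 'M[R]_(d, m)) (Y :
  'M[R]_(d, n)) (e : R) :
  (m + n + m <= d)%N -> 0 < e -> exists2 r, 0 < r & forall Z, `|Z - X^T *m Y| < r ->
    exists X' Y', [/\ `|X' - X| < e, `|Y' - Y| < e & X'^T *m Y' = Z].
Proof.
move=> mnd e0.
have [V Vf VC] := exists_orthogonal_rows R m (m + n) d (row_mx X Y) mnd.
move: VC; rewrite mul_mx_row => /eqP; rewrite row_mx_eq0 => /andP[/eqP VX /eqP VY].
pose Q := V *m V^T; have Qu : Q \in unitmx by exact: gram_unitmx.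
(* The perturbation of [X] is below [e] whatever [E] is; smallness of [E] relative to [a] then
   controls that of [Y]. *)
pose a : R := e / (`|V^T| + 1).
have K0 : 0 < `|V^T| + 1 by rewrite ltr_wpDl.
have a0 : 0 < a by rewrite divr_gt0.
pose K := m%:R * `|V^T *m invmx Q| + 1.
have K'0 : 0 < K by rewrite ltr_wpDl// mulr_ge0.
exists (a * e / K) => [|Z Zr]; first by rewrite divr_gt0// mulr_gt0.
have [E EZ] : exists E, E = Z - X^T *m Y by eexists.
rewrite -EZ in Zr.
exists (X + a *: V^T), (Y + a^-1 *: (V^T *m invmx Q *m E)); split.
- rewrite addrAC subrr add0r normrZ gtr0_norm// /a -mulrA gtr_pMr// mulrC.
  by rewrite ltr_pdivrMr// mul1r ltrDl.
- rewrite addrAC subrr add0r normrZ gtr0_norm ?invr_gt0// mulrC ltr_pdivrMr//.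
  rewrite (le_lt_trans (mx_norm_mul _ _ _ _ _ _))//.
  apply: (@le_lt_trans _ _ (K * `|E|)); first by rewrite ler_wpM2r// lerDl.
  by rewrite mulrC -ltr_pdivlMr// (mulrC e).
- have XV : X^T *m V^T = 0 by rewrite -trmx_mul VX trmx0.
  rewrite [(X + _)^T]linearD/= [(a *: _)^T]linearZ/= trmxK mulmxDl !mulmxDr
    -!scalemxAr -!scalemxAl.
  rewrite VY scaler0 add0r !mulmxA XV !mul0mx !scaler0 addr0.
  by rewrite scalerA mulVf ?gt_eqF// scale1r -/Q mulmxV// mul1mx EZ addrC subrK.
Qed.

Lemma H_MF_open (R : realType) (d m n : nat) (X : 'M[R]_(d, m)) (Y :
  'M[R]_(d, n)) (e : R) :
  (m + n + minn m n <= d)%N -> 0 < e -> exists2 r, 0 < r & forall Z,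
    `|Z - X^T *m Y| < r ->
    exists X' Y', [/\ `|X' - X| < e, `|Y' - Y| < e & X'^T *m Y' = Z].
Proof.
have [mn|/ltnW nm] := leqP m n; first exact: H_MF_open_left.
(* For [n < m] the roles of [X] and [Y] are exchanged by transposing the product. *)
rewrite (addnC m) => mnd e0.
have [r r0 rP] := H_MF_open_left R d n m Y X e mnd e0.
exists r => // Z Zr; have [|Y' [X' [Y'Y X'X YXZ]]] := rP Z^T.
  rewrite (_ : Z^T - _ = (Z - X^T *m Y)^T) ?mx_norm_tr//.
  by rewrite linearB/= trmx_mul trmxK.
by exists X', Y'; split => //; rewrite -[RHS]trmxK -YXZ trmx_mul trmxK.
Qed.

(** * The inner product of pairs and the derivative of the factorization map *)

Lemma frob_pairDl (R : realType) (d m n : nat) (P Q S : 'M[R]_(d, m) * 'M[R]_(d, n)) :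
  frob_pair (P + Q) S = frob_pair P S + frob_pair Q S.
Proof. by rewrite /frob_pair /= !frobDl; ring. Qed.

Lemma frob_pairZl (R : realType) (d m n : nat) (a : R) (P Q :
  'M[R]_(d, m) * 'M[R]_(d, n)) :
  frob_pair (a *: P) Q = a * frob_pair P Q.
Proof. by rewrite /frob_pair /= !frobZl mulrDr. Qed.

Lemma frob_pairC (R : realType) (d m n : nat) (P Q : 'M[R]_(d, m) * 'M[R]_(d, n)) :
  frob_pair P Q = frob_pair Q P.
Proof. by rewrite /frob_pair frobC (frobC _ _ _ _ Q.2). Qed.

Lemma frob_pair_ge0 (R : realType) (d m n : nat) (P : 'M[R]_(d, m) * 'M[R]_(d, n)) :
  0 <= frob_pair P P.
Proof. by rewrite addr_ge0// frob_ge0. Qed.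

Lemma frob_pair_eq0 (R : realType) (d m n : nat) (P : 'M[R]_(d, m) * 'M[R]_(d, n)) :
  frob_pair P P = 0 -> P = 0.
Proof.
case: P => A B /eqP; rewrite /frob_pair paddr_eq0 ?frob_ge0//= =>
  /andP[/eqP A0 /eqP B0].
by rewrite (frob_eq0 _ _ _ _ A0) (frob_eq0 _ _ _ _ B0).
Qed.

Lemma frob_pair_norm_le (R : realType) (d m n : nat) (P Q :
  'M[R]_(d, m) * 'M[R]_(d, n)) :
  `|frob_pair P Q| <= (d * m + d * n)%:R * `|P| * `|Q|.
Proof.
rewrite (le_trans (ler_normD _ _))// natrD !mulrDl lerD//.
  apply: le_trans (frob_le R d m P.1 Q.1 `|P| _) _ => [i j|].
    by rewrite (le_trans (le_entry_mx_norm _ _ _ _ _ _))// prod_normE le_max lexx.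
  by rewrite ler_wpM2l ?mulr_ge0// prod_normE le_max lexx.
apply: le_trans (frob_le R d n P.2 Q.2 `|P| _) _ => [i j|].
  by rewrite (le_trans (le_entry_mx_norm _ _ _ _ _ _))// prod_normE le_max lexx orbT.
by rewrite ler_wpM2l ?mulr_ge0// prod_normE le_max lexx orbT.
Qed.

Lemma riesz_frob_pair (R : realType) (d m n : nat)
    (phi : 'M[R]_(d, m) * 'M[R]_(d, n) -> R) (v : 'M[R]_(d, m) * 'M[R]_(d, n)) :
  (forall u, frob_pair v u = phi u) -> riesz (@frob_pair R d m n) phi = v.
Proof.
move=> vphi; rewrite /riesz; set S := (X in get X).
have Sv : S v by [].
have Sg := @getPex _ S (ex_intro _ v Sv).
apply/eqP; rewrite -subr_eq0; apply/eqP; apply: frob_pair_eq0.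
by rewrite frob_pairDl -scaleN1r frob_pairZl Sg vphi; ring.
Qed.

Definition H_MF_diff (R : realType) (d m n : nat) (P : 'M[R]_(d, m) * 'M[R]_(d, n))
    (h : 'M[R]_(d, m) * 'M[R]_(d, n)) : 'M[R]_(m, n) :=
  h.1^T *m P.2 + P.1^T *m h.2.

Lemma H_MF_diff_linear (R : realType) (d m n : nat) (P : 'M[R]_(d, m) * 'M[R]_(d, n)) :
  linear (H_MF_diff R d m n P).
Proof.
move=> a [A B] [A' B']; rewrite /H_MF_diff/=.
rewrite [(a *: A + A')^T]linearD/= [(a *: A)^T]linearZ/= mulmxDl mulmxDr.
by rewrite -scalemxAl -scalemxAr scalerDr addrACA.
Qed.

HB.instance Definition _ (R : realType) (d m n : nat) (P :
  'M[R]_(d, m) * 'M[R]_(d, n)) :=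
  GRing.isLinear.Build R ('M[R]_(d, m) * 'M[R]_(d, n))%type 'M[R]_(m, n) _
    (H_MF_diff R d m n P) (H_MF_diff_linear R d m n P).

Lemma H_MF_expansion (R : realType) (d m n : nat) (P h : 'M[R]_(d, m) * 'M[R]_(d, n)) :
  H_MF (P + h) = H_MF P + H_MF_diff R d m n P h + H_MF h.
Proof.
rewrite /H_MF /H_MF_diff /= [(P.1 + h.1)^T]linearD/= mulmxDl !mulmxDr.
by rewrite -!addrA; congr (_ + _); rewrite [RHS]addrCA.
Qed.

Lemma H_MF_norm_le (R : realType) (d m n : nat) (P : 'M[R]_(d, m) * 'M[R]_(d, n)) :
  `|H_MF P| <= d%:R * `|P| * `|P|.
Proof.
rewrite (le_trans (mx_norm_mul _ _ _ _ _ _))// mx_norm_tr.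
by rewrite ler_pM ?mulr_ge0// ?ler_wpM2l// prod_normE le_max lexx ?orbT.
Qed.

Lemma H_MF_diff_norm_le (R : realType) (d m n : nat) (P h :
  'M[R]_(d, m) * 'M[R]_(d, n)) :
  `|H_MF_diff R d m n P h| <= 2 * d%:R * `|P| * `|h|.
Proof.
have -> : 2 * d%:R * `|P| * `|h| = d%:R * `|h| * `|P| + d%:R * `|P| * `|h| by ring.
rewrite (le_trans (ler_normD _ _))// lerD// (le_trans (mx_norm_mul _ _ _ _ _ _))//
  mx_norm_tr;
  by rewrite ler_pM ?mulr_ge0// ?ler_wpM2l// prod_normE le_max lexx ?orbT.
Qed.

(** The remainder of the expansion is [H_MF h], which is quadratic in [h]. *)
Lemma differentiable_H_MF (R : realType) (d m n : nat) (P :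
  'M[R]_(d, m) * 'M[R]_(d, n)) :
  differentiable (@H_MF R d m n) P /\
  'd (@H_MF R d m n) P = H_MF_diff R d m n P :> (_ -> _).
Proof.
apply: expansion_differentiable.
  apply: (continuous_of_lipschitz _ _ _ _ (2 * d%:R * `|P|)) => x y.
  by rewrite -linearB; exact: H_MF_diff_norm_le.
move=> e e0; pose K : R := d%:R + 1.
have K0 : 0 < K by rewrite ltr_wpDl.
exists (e / K) => [|h hK]; first by rewrite divr_gt0.
rewrite H_MF_expansion (_ : _ - _ = H_MF h);
  last by rewrite -addrA -opprD addrAC subrr add0r.
rewrite (le_trans (H_MF_norm_le _ _ _ _ _))// ler_wpM2r//.
apply: (@le_trans _ _ (K * `|h|)); first by rewrite ler_wpM2r// lerDl.
by rewrite mulrC -ler_pdivlMr// ltW.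
Qed.

(** The closed form of the transposed Jacobian, obtained by moving the factors of [H_MF_diff] across
    the trace. *)
Definition H_MF_adjoint (R : realType) (d m n : nat) (P : 'M[R]_(d, m) * 'M[R]_(d, n))
    (S : 'M[R]_(m, n)) : 'M[R]_(d, m) * 'M[R]_(d, n) := (P.2 *m S^T, P.1 *m S).

Lemma H_MF_adjointP (R : realType) (d m n : nat) (P h : 'M[R]_(d, m) * 'M[R]_(d, n))
    (S : 'M[R]_(m, n)) :
  frob_pair (H_MF_adjoint R d m n P S) h = frob S (H_MF_diff R d m n P h).
Proof.
rewrite frobDr /frob_pair /frob /=; congr (_ + _); last by rewrite trmx_mul mulmxA.
rewrite trmx_mul trmxK -mulmxA mxtrace_mulC -[LHS]mxtrace_tr !trmx_mul !trmxK.
by rewrite mulmxA.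
Qed.

Lemma jacobian_tr_H_MF (R : realType) (d m n : nat) (P : 'M[R]_(d, m) * 'M[R]_(d, n)) :
  jacobian_tr (@frob_pair R d m n) (@frob R m n) (@H_MF R d m n) P =
  H_MF_adjoint R d m n P.
Proof.
apply/funext => S; apply: riesz_frob_pair => u; rewrite H_MF_adjointP.
by have [_ ->] := differentiable_H_MF R d m n P.
Qed.

Lemma gradient_comp_H_MF (R : realType) (d m n : nat) (f : 'M[R]_(m, n) -> R)
    (P : 'M[R]_(d, m) * 'M[R]_(d, n)) :
  differentiable f (H_MF P) ->
  differentiable (f \o @H_MF R d m n) P /\
  gradient (@frob_pair R d m n) (f \o @H_MF R d m n) P =
  H_MF_adjoint R d m n P (gradient (@frob R m n) f (H_MF P)).
Proof.
move=> df; have [dH dHE] := differentiable_H_MF R d m n P.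
split; first exact: differentiable_comp.
apply: riesz_frob_pair => u; rewrite H_MF_adjointP frob_gradient -dHE.
by rewrite (diff_comp dH df).
Qed.

Lemma H_MFZ (R : realType) (d m n : nat) (a : R) (P : 'M[R]_(d, m) * 'M[R]_(d, n)) :
  H_MF (a *: P) = a ^+ 2 *: H_MF P.
Proof.
by rewrite /H_MF /= [(a *: P.1)^T]linearZ/= -scalemxAr -scalemxAl scalerA expr2.
Qed.

Lemma H_MF_diffBl (R : realType) (d m n : nat) (P Q h : 'M[R]_(d, m) * 'M[R]_(d, n)) :
  H_MF_diff R d m n (P - Q) h = H_MF_diff R d m n P h - H_MF_diff R d m n Q h.
Proof.
rewrite /H_MF_diff /= [(P.1 - Q.1)^T]linearB/= mulmxBr mulmxBl.
by rewrite opprD addrACA.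
Qed.

Lemma H_MF_adjoint_norm_le (R : realType) (d m n : nat)
    (P : 'M[R]_(d, m) * 'M[R]_(d, n)) (S : 'M[R]_(m, n)) :
  `|H_MF_adjoint R d m n P S| <= (m + n)%:R * `|P| * `|S|.
Proof.
rewrite prod_normE /= ge_max !(le_trans (mx_norm_mul _ _ _ _ _ _))// ?mx_norm_tr.
  by rewrite ler_wpM2r// ler_pM// ?ler_nat ?leq_addr// prod_normE le_max lexx.
by rewrite ler_wpM2r// ler_pM// ?ler_nat ?leq_addl// prod_normE le_max lexx orbT.
Qed.

Lemma H_MF_adjointDr (R : realType) (d m n : nat)
    (P : 'M[R]_(d, m) * 'M[R]_(d, n)) (S T : 'M[R]_(m, n)) :
  H_MF_adjoint R d m n P (S + T) = H_MF_adjoint R d m n P S + H_MF_adjoint R d m n P T.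
Proof. by rewrite /H_MF_adjoint [(S + T)^T]linearD/= !mulmxDr. Qed.

Lemma H_MF_adjointZr (R : realType) (d m n : nat)
    (P : 'M[R]_(d, m) * 'M[R]_(d, n)) (a : R) (S : 'M[R]_(m, n)) :
  H_MF_adjoint R d m n P (a *: S) = a *: H_MF_adjoint R d m n P S.
Proof. by rewrite /H_MF_adjoint [(a *: S)^T]linearZ/= -!scalemxAr. Qed.

Lemma H_MF_adjointBr (R : realType) (d m n : nat)
    (P : 'M[R]_(d, m) * 'M[R]_(d, n)) (S T : 'M[R]_(m, n)) :
  H_MF_adjoint R d m n P (S - T) = H_MF_adjoint R d m n P S - H_MF_adjoint R d m n P T.
Proof. by rewrite -scaleN1r H_MF_adjointDr H_MF_adjointZr scaleN1r. Qed.

Lemma H_MF_adjointBl (R : realType) (d m n : nat)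
    (P Q : 'M[R]_(d, m) * 'M[R]_(d, n)) (S : 'M[R]_(m, n)) :
  H_MF_adjoint R d m n (P - Q) S = H_MF_adjoint R d m n P S - H_MF_adjoint R d m n Q S.
Proof. by rewrite /H_MF_adjoint /= !mulmxBl. Qed.

(** * Limiting gradients of the composition *)

(** A point of differentiability [z] near [H_MF P] lifts by openness to some [Q] near [P], where the
    gradient of the composition is the adjoint at [Q] of the gradient at [z]. *)
Lemma limiting_gradients_H_MF (R : realType) (d m n : nat) (f : 'M[R]_(m, n) -> R)
    (P : 'M[R]_(d, m) * 'M[R]_(d, n)) (s : 'M[R]_(m, n)) :
  (m + n + minn m n <= d)%N ->
  limiting_gradients (@frob R m n) f (H_MF P) s ->
  limiting_gradients (@frob_pair R d m n) (f \o @H_MF R d m n) P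
    (H_MF_adjoint R d m n P s).
Proof.
move=> mnd /limiting_gradientsP sG; apply/limiting_gradientsP => e e0.
pose K := (m + n)%:R * (`|P| + 1 + `|s|) + 1.
have K0 : 0 < K by rewrite ltr_wpDl// mulr_ge0// !addr_ge0.
pose q := Num.min (Num.min 1 e) (e / K).
have q0 : 0 < q by rewrite !lt_min ltr01 e0 divr_gt0.
have [q1 qe qK] : [/\ q <= 1, q <= e & q * K <= e].
  by split; rewrite -?ler_pdivlMr// /q !ge_min ?lexx ?orbT.
have [r r0 rP] := H_MF_open R d m n P.1 P.2 q mnd q0.
have [|z [zZ dz zs]] := sG (Num.min r q); first by rewrite lt_min r0.
move: zZ zs; rewrite lt_min => /andP[zr _]; rewrite lt_min => /andP[_ zs].
have [X' [Y' [X'q Y'q HE]]] := rP z zr.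
pose Q : 'M[R]_(d, m) * 'M[R]_(d, n) := (X', Y').
have HQ : H_MF Q = z by [].
have QP : `|Q - P| < q by rewrite prod_normE gt_max X'q.
have dQ : differentiable f (H_MF Q) by rewrite HQ.
have [dfQ gQ] := gradient_comp_H_MF R d m n f Q dQ.
exists Q; split => //; first exact: lt_le_trans qe.
rewrite gQ HQ; set g := gradient _ _ _ in zs *.
(* The two terms are at most [(m + n) * (|P| + 1) * q] and [(m + n) * q * |s|]; their sum is
   [q * (K - 1)], hence below [q * K]. *)
have -> : H_MF_adjoint R d m n Q g - H_MF_adjoint R d m n P s =
    H_MF_adjoint R d m n Q (g - s) + H_MF_adjoint R d m n (Q - P) s.
  by rewrite H_MF_adjointBr H_MF_adjointBl addrA subrK.
have Q1 : `|Q| <= `|P| + 1.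
  by rewrite -(subrK P Q) addrC (le_trans (ler_normD _ _))// lerD2l (le_trans (ltW QP)).
apply: lt_le_trans qK; rewrite /K mulrDr mulr1.
apply: (@le_lt_trans _ _ (q * ((m + n)%:R * (`|P| + 1 + `|s|)))); last by rewrite ltrDl.
rewrite (le_trans (ler_normD _ _))//.
have -> : q * ((m + n)%:R * (`|P| + 1 + `|s|)) =
   (m + n)%:R * (`|P| + 1) * q + (m + n)%:R * q * `|s| by ring.
rewrite lerD// (le_trans (H_MF_adjoint_norm_le _ _ _ _ _ _))//.
  by apply: ler_pM => //; [rewrite ler_wpM2l|exact: (ltW zs)].
rewrite ler_wpM2r//; rewrite ler_wpM2l//; exact: (ltW QP).
Qed.

(** The composition may be differentiable at [Q] although [f] is not at [H_MF Q], so the chain rule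
    is replaced by increments: that of the composition along [h] is close to that of [f] along [v],
    which puts [frob_pair s h] below the generalized derivative of [f] along [v]. *)
Lemma limiting_gradient_H_MF_directional (R : realType) (d m n : nat)
    (f : 'M[R]_(m, n) -> R) (P s h : 'M[R]_(d, m) * 'M[R]_(d, n)) :
  locally_lipschitz f ->
  limiting_gradients (@frob_pair R d m n) (f \o @H_MF R d m n) P s ->
  exists2 g, limiting_gradients (@frob R m n) f (H_MF P) g &
    frob_pair s h <= frob_pair (H_MF_adjoint R d m n P g) h.
Proof.
move=> fl /limiting_gradientsP sG.
have [r [L0 [g [r0 gL0 gf]]]] := locally_lipschitz_extension R m n f (H_MF P) fl.
have [L L0' gL] : exists2 L : R, 0 < L & forall x y, `|g x - g y| <= L * `|x - y|.
  exists (`|L0| + 1); first by rewrite ltr_wpDl.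
  move=> x y; rewrite (le_trans (gL0 _ _))// ler_wpM2r//.
  by rewrite (le_trans (ler_norm _))// lerDl.
pose v := H_MF_diff R d m n P h.
have [|w wG sw] := limiting_gradient_directional R m n f (H_MF P) v (frob_pair s h)
  fl; last first.
  by exists w => //; rewrite H_MF_adjointP.
move=> e e0.
(* The error [e] is split in fifths: one for replacing [s] by the gradient at [Q], one for its
   expansion, two for replacing the curved increment by the straight one, and one for strictness. *)
pose Kh := (d * m + d * n)%:R * `|h| + 1.
have Kh0 : 0 < Kh by rewrite ltr_wpDl// mulr_ge0.
pose Kd := L * (2 * d%:R * `|h|) + 1.
have Kd0 : 0 < Kd by rewrite ltr_wpDl// !mulr_ge0// ltW.
have cH : {for P, continuous (@H_MF R d m n)}.
  by apply: differentiable_continuous; have [] := differentiable_H_MF R d m n P.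
have er0 : 0 < Num.min e r by rewrite lt_min e0.
have : nbhs P [set Q | `|H_MF Q - H_MF P| < Num.min e r].
  have /cvgrPdist_lt/(_ _ er0) := cH.
  by apply: filterS => Q; rewrite distrC.
move=> /nbhs_ballP[u /= u0 uP].
pose a := Num.min u (Num.min (e / 5 / Kh) (e / 5 / Kd)).
have a0 : 0 < a by rewrite !lt_min u0 !divr_gt0.
have [Q [QP dQ Qs]] := sG a a0.
have [au aKh aKd] : [/\ a <= u, a * Kh <= e / 5 & a * Kd <= e / 5].
  by split; rewrite -?ler_pdivlMr// /a !ge_min ?lexx ?orbT.
have HQ : `|H_MF Q - H_MF P| < Num.min e r.
  by apply: uP; rewrite -ball_normE /= distrC (lt_le_trans QP).
have dfh : frob_pair s h - e / 5 <= 'd (f \o @H_MF R d m n) Q h.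
  have <- : frob_pair (gradient (@frob_pair R d m n) (f \o @H_MF R d m n) Q) h =
      'd (f \o @H_MF R d m n) Q h by exact: frob_pair_riesz.
  set G := gradient _ _ _ in Qs *.
  have : `|frob_pair (s - G) h| <= e / 5.
    rewrite (le_trans (frob_pair_norm_le _ _ _ _ _ _))// mulrAC.
    apply: le_trans aKh; rewrite mulrC; apply: ler_pM => //; last by rewrite lerDl.
    by rewrite distrC; exact: ltW Qs.
  rewrite frob_pairDl -scaleN1r frob_pairZl mulN1r ler_norml => /andP[_].
  by rewrite lerBlDr addrC -lerBlDr.
have e50 : 0 < e / 5 by rewrite divr_gt0.
pose b := e / 5 / (`|h| + 1).
have h10 : 0 < `|h| + 1 by rewrite ltr_wpDl.
have b0 : 0 < b by rewrite divr_gt0.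
have [q q0 qP] := differentiable_expansion R _ R^o _ Q dQ b b0.
have LH0 : 0 < L * `|H_MF h| + 1 by rewrite ltr_wpDl// mulr_ge0// ltW.
have uQ : 0 < u - `|Q - P| by rewrite subr_gt0 (lt_le_trans QP).
have v10 : 0 < `|v| + 1 by rewrite ltr_wpDl.
have rQ : 0 < r - `|H_MF Q - H_MF P|.
  by rewrite subr_gt0 (lt_le_trans HQ)// ge_min lexx orbT.
(* The step [t] keeps both end points where [f] and [g] agree, [t *: h] within the radius of the
   expansion, and the quadratic term [H_MF h] below its fifth. *)
have [t [t0 te [tu tq tH tv]]] : exists t, [/\ 0 < t, t < e &
    [/\ t * (`|h| + 1) <= u - `|Q - P|, t * (`|h| + 1) <= q / 2,
     t * (L * `|H_MF h| + 1) <= e / 5 & t * (`|v| + 1) <= (r - `|H_MF Q - H_MF P|) /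
       2]].
  pose c := Num.min (Num.min (e / 2) ((u - `|Q - P|) / (`|h| + 1)))
    (Num.min (Num.min (q / 2 / (`|h| + 1)) (e / 5 / (L * `|H_MF h| + 1)))
      ((r - `|H_MF Q - H_MF P|) / 2 / (`|v| + 1))).
  exists c; split.
  - by rewrite !lt_min !divr_gt0.
  - apply: (@le_lt_trans _ _ (e / 2)); first by rewrite !ge_min lexx.
    by rewrite ltr_pdivrMr// ltr_pMr// ltr1n.
  - by split; rewrite -?ler_pdivlMr// /c !ge_min ?lexx ?orbT.
have {}tq : `|t *: h| < q.
  rewrite normrZ gtr0_norm// (@le_lt_trans _ _ (q / 2))//.
    by rewrite (le_trans _ tq)// ler_wpM2l ?(ltW t0)// lerDl.
  by rewrite ltr_pdivrMr// ltr_pMr// ltr1n.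
have Qu : `|H_MF (Q + t *: h) - H_MF P| < r.
  apply: lt_le_trans (uP _ _) _; last by rewrite ge_min lexx orbT.
  rewrite -ball_normE /= distrC addrAC (le_lt_trans (ler_normD _ _))// -ltrBrDl.
  by rewrite (lt_le_trans _ tu)// normrZ gtr0_norm// ltr_pM2l// ltrDl.
have vr : `|H_MF Q + t *: v - H_MF P| < r.
  rewrite addrAC (le_lt_trans (ler_normD _ _))// -ltrBrDl normrZ gtr0_norm//.
  apply: (@lt_trans _ _ ((r - `|H_MF Q - H_MF P|) / 2)).
    by rewrite (lt_le_trans _ tv)// ltr_pM2l// ltrDl.
  by rewrite ltr_pdivrMr// ltr_pMr// ltr1n.
have Qr : `|H_MF Q - H_MF P| < r by rewrite (lt_le_trans HQ)// ge_min lexx orbT.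
exists (H_MF Q), t; split.
- by rewrite (lt_le_trans HQ)// ge_min lexx.
- by rewrite t0.
have A1 := qP _ tq.
have {A1} : `|f (H_MF (Q + t *: h)) - f (H_MF Q) - t * 'd (f \o @H_MF R d m n) Q h|
  <= e / 5 * t.
  move: A1; rewrite linearZ => /le_trans; apply.
  have -> : b * `|t *: h| = e / 5 * t * (`|h| / (`|h| + 1)).
    by rewrite normrZ gtr0_norm// /b; ring.
  apply: ler_piMr; first exact: mulr_ge0 (ltW e50) (ltW t0).
  by rewrite ler_pdivrMr// mul1r lerDl.
have : `|g (H_MF Q + t *: v) - g (H_MF (Q + t *: h))| <= 2 * (e / 5) * t.
  rewrite (le_trans (gL _ _))// H_MF_expansion.
  (* The end points differ by a term that is small because [Q] is near [P] and one that is small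
     because [t] is. *)
  have -> : H_MF Q + t *: v - (H_MF Q + H_MF_diff R d m n Q (t *: h) + H_MF (t *: h)) =
      t *: (H_MF_diff R d m n (P - Q) h - t *: H_MF h).
    rewrite linearZ/= H_MFZ scalerBr scalerA -expr2 opprD addrA; congr (_ - _).
    by rewrite addrAC opprD addrA subrr add0r H_MF_diffBl scalerBr addrC.
  rewrite normrZ gtr0_norm// mulrCA mulrC; apply: ler_wpM2r; first exact: ltW.
  have -> : 2 * (e / 5) = e / 5 + e / 5 by ring.
  apply: (@le_trans _ _ (L * (`|H_MF_diff R d m n (P - Q) h| + `|t *: H_MF h|))).
    by rewrite ler_wpM2l ?(ltW L0')// ler_normB.
  rewrite mulrDr lerD//.
    apply: le_trans aKd; apply: (@le_trans _ _ (a * (L * (2 * d%:R * `|h|))));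
      last first.
      by rewrite ler_wpM2l ?(ltW a0)// lerDl.
    apply: (@le_trans _ _ (L * (2 * d%:R * `|P - Q| * `|h|))).
      by rewrite ler_wpM2l ?(ltW L0')// H_MF_diff_norm_le.
    have -> : L * (2 * d%:R * `|P - Q| * `|h|) = `|P - Q| * (L * (2 * d%:R * `|h|))
      by ring.
    by rewrite distrC; apply: ler_wpM2r (ltW QP); rewrite !mulr_ge0// ltW.
  apply: le_trans tH; rewrite normrZ gtr0_norm// mulrCA; apply: ler_wpM2l;
    first exact: ltW.
  by rewrite lerDl.
rewrite !gf//.
move: dfh; set D := 'd _ _ _; set F1 := f (H_MF Q + _); set F2 := f (H_MF (Q + _)).
set F3 := f (H_MF Q); set S := frob_pair s h.
rewrite !ler_norml => dfh /andP[H1 _] /andP[H2 _].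
have : t * (S - e / 5) <= t * D by rewrite ler_wpM2l// ltW.
have : 0 < t * (e / 5) by rewrite mulr_gt0.
lra.
Qed.

Lemma continuous_at_lipschitz (R : realType) (V : normedModType R) (q : V -> R)
    (x : V) (K : R) :
  (forall y, `|x - y| <= 1 -> `|q x - q y| <= K * `|x - y|) -> {for x, continuous q}.
Proof.
move=> qK; apply/cvgrPdist_le => e e0.
have K0 : 0 < `|K| + 1 by rewrite ltr_wpDl.
near=> y.
have y1 : `|x - y| <= 1.
  by near: y; apply: cvgr_dist_le => //; exact: cvg_id.
have yK : `|x - y| <= e / (`|K| + 1).
  by near: y; apply: cvgr_dist_le; [exact: cvg_id|rewrite divr_gt0].
rewrite (le_trans (qK y y1))// (@le_trans _ _ ((`|K| + 1) * `|x - y|))//.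
  by rewrite ler_wpM2r// (le_trans (ler_norm K))// lerDl.
by rewrite mulrC -ler_pdivlMr.
Unshelve. all: by end_near. Qed.

Lemma continuous_frob_sqr (R : realType) (m n : nat) :
  continuous (fun A : 'M[R]_(m, n) => frob A A).
Proof.
move=> A; apply: (continuous_at_lipschitz R _ _ A ((m * n)%:R * (2 * `|A| + 1))) =>
  B B1.
have -> : frob A A - frob B B = frob (A + B) (A - B).
  by rewrite frobDl !frobDr !(frobC R m n _ (- B)) !frobNl (frobC _ _ _ B A); ring.
have AB : `|A + B| <= 2 * `|A| + 1.
  have -> : A + B = A + A - (A - B) by rewrite opprB addrACA subrr addr0.
  rewrite (le_trans (ler_normB _ _))// lerD//.
  by rewrite (le_trans (ler_normD _ _))// mulr_natl mulr2n.
apply: frob_le => i j; exact: le_trans (le_entry_mx_norm _ _ _ _ _ _) AB.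
Qed.

Lemma continuous_frob_pair_sqr (R : realType) (d m n : nat) :
  continuous (fun P : 'M[R]_(d, m) * 'M[R]_(d, n) => frob_pair P P).
Proof.
move=> P; apply: (@cvgD _ R^o).
  by apply: (@continuous_comp _ _ _ fst (fun A => frob A A));
    [exact: cvg_fst|exact: continuous_frob_sqr].
by apply: (@continuous_comp _ _ _ snd (fun A => frob A A));
  [exact: cvg_snd|exact: continuous_frob_sqr].
Qed.

Lemma frob_pairBl (R : realType) (d m n : nat) (P Q S : 'M[R]_(d, m) * 'M[R]_(d, n)) :
  frob_pair (P - Q) S = frob_pair P S - frob_pair Q S.
Proof. by rewrite frob_pairDl -scaleN1r frob_pairZl mulN1r. Qed.

(* If [s] were not the point [H_MF_adjoint P c] of the image closest to it, the
   direction from that point to [s] would violate the directional bound. *)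
Lemma limiting_gradient_comp_H_MF (R : realType) (d m n : nat)
    (f : 'M[R]_(m, n) -> R) (P s : 'M[R]_(d, m) * 'M[R]_(d, n)) :
  locally_lipschitz f ->
  limiting_gradients (@frob_pair R d m n) (f \o @H_MF R d m n) P s ->
  (H_MF_adjoint R d m n P @` clarke_subdiff (@frob R m n) f (H_MF P)) s.
Proof.
move=> fl sG; set C := clarke_subdiff _ _ _.
have cC : compact C by apply: compact_conv_hull; exact: compact_limiting_gradients.
have dir h := limiting_gradient_H_MF_directional R d m n f P s h fl sG.
have C0 : C !=set0.
  by have [g Gg _] := dir 0; exists g; exact: sub_gen_smallest.
pose T c := s - H_MF_adjoint R d m n P c.
have cT : continuous T.
  apply: (continuous_of_lipschitz R _ _ _ ((m + n)%:R * `|P|)) => a b.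
  rewrite (_ : T a - T b = - H_MF_adjoint R d m n P (a - b)); last first.
    by rewrite H_MF_adjointBr opprB /T addrACA addrC addrA subrK opprD opprK.
  by rewrite normrN; exact: H_MF_adjoint_norm_le.
have [|c /set_mem Cc cmin] := compact_EVT_min (f :=
  fun c => frob_pair (T c) (T c)) C0 cC.
  apply: continuous_subspaceT => x.
  exact: (continuous_comp (cT x) (continuous_frob_pair_sqr R d m n (T x))).
have [h hT] : exists h, T c = h by eexists.
(* First-order optimality of [c]: moving from [c] towards [g] stays in [C], and cannot decrease the
   squared distance to [s]. *)
have var g : limiting_gradients (@frob R m n) f (H_MF P) g ->
    frob_pair h (H_MF_adjoint R d m n P (g - c)) <= 0.
  move=> Gg; set w := H_MF_adjoint _ _ _ _ _ _.
  apply/ler_addgt0Pr => e e0; rewrite add0r.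
  pose K := frob_pair w w + 1.
  have K0 : 0 < K by rewrite ltr_wpDl// frob_pair_ge0.
  (* The second-order term [t ^ 2 * frob_pair w w] is then absorbed by [t * e]. *)
  pose t := Num.min 1 (e / K).
  have t0 : 0 < t by rewrite lt_min ltr01 divr_gt0.
  have t1 : t <= 1 by rewrite ge_min lexx.
  have tK : t * K <= e by rewrite -ler_pdivlMr// ge_min lexx orbT.
  have Ct : C (t *: g + (1 - t) *: c).
    by apply: conv_hull_mix => //; [exact: ltW|exact: sub_gen_smallest].
  have := cmin _ (mem_set Ct).
  have -> : T (t *: g + (1 - t) *: c) = h - t *: w.
    rewrite -hT /T /w -H_MF_adjointZr -addrA -opprD -H_MF_adjointDr;
      congr (_ - H_MF_adjoint _ _ _ _ _ _).
    by rewrite scalerBl scale1r scalerBr addrCA addrA addrC addrA.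
  rewrite hT frob_pairBl frob_pairZl (frob_pairC _ _ _ _ h (_ - _)).
  rewrite (frob_pairC _ _ _ _ w (_ - _)) !frob_pairBl !frob_pairZl.
  rewrite (frob_pairC _ _ _ _ w h) => H.
  rewrite -(ler_pM2l t0).
  have : t * (t * K) <= t * e by rewrite ler_wpM2l// ltW.
  have : 0 <= frob_pair w w by exact: frob_pair_ge0.
  have : 0 < t * t by rewrite mulr_gt0.
  rewrite /K; nra.
(* For the direction [h = T c], the bound of [dir] and the optimality of [c] combine to
   [frob_pair h h <= 0]. *)
have [g Gg] := dir h.
have := var g Gg; rewrite H_MF_adjointBr frob_pairC frob_pairBl => H1 H2.
exists c => //; apply/esym/eqP; rewrite -subr_eq0; apply/eqP; apply: frob_pair_eq0.
rewrite -/(T c) hT; apply/eqP; rewrite eq_le frob_pair_ge0 andbT.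
rewrite -{1}hT /T frob_pairBl.
lra.
Qed.

Theorem corollary3p7 (R : realType) (m n d : nat)
    (hm : (0 < m)%N) (hn : (0 < n)%N) (hd : (0 < d)%N)
    (hdmn : (m + n + minn m n <= d)%N)
    (ell : 'M[R]_(m, n) -> R) (hell : locally_lipschitz ell)
    (X : 'M[R]_(d, m)) (Y : 'M[R]_(d, n)) :
  clarke_subdiff (@frob_pair R d m n) (ell \o @H_MF R d m n) (X, Y) =
  jacobian_tr (@frob_pair R d m n) (@frob R m n) (@H_MF R d m n) (X, Y)
    @` clarke_subdiff (@frob R m n) ell (X^T *m Y).
Proof.
(* The adjoint is linear, so images and preimages of convex sets under it are convex; each inclusion
   need only be checked on limiting gradients. *)
rewrite jacobian_tr_H_MF; apply/seteqP; split.
  apply: conv_hull_min => [_ _ t t0 t1 [a Ca <-] [b Cb <-]|s]; last first.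
    exact: limiting_gradient_comp_H_MF.
  exists (t *: a + (1 - t) *: b); first exact: conv_hull_mix.
  by rewrite H_MF_adjointDr !H_MF_adjointZr.
move=> _ [s Cs <-]; move: s Cs.
apply: conv_hull_min => [a b t t0 t1 Ca Cb|s Gs].
  by rewrite H_MF_adjointDr !H_MF_adjointZr; exact: conv_hull_mix.
by apply: sub_gen_smallest; exact: limiting_gradients_H_MF.
Qed.
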